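(* There exists a separable dual Banach space $X$ which is universal for the class $\mathcal{C}_{\mathrm{auc}}$ of all separable reflexive Banach spaces having an equivalent a.u.c. norm, i.e. every member of $\mathcal{C}_{\mathrm{auc}}$ is isomorphic to a closed subspace of $X$. Moreover, $X$ is the $\ell_2$-sum of a sequence of a.u.c. spaces.
   Context: Banach spaces are real, separable and infinite dimensional. $\operatorname{cof}(X)$ is the set of closed finite codimensional subspaces of $X$. For $t>0$, $\bar\delta_X(t)=\inf_{\|x\|=1}\sup_{Y\in\operatorname{cof}(X)}\inf_{y\in Y,\ \|y\|\ge t}\|x+y\|-1$. $X$ is a.u.c. (asymptotically uniformly convex) if $\bar\delta_X(t)>0$ for all $t>0$. A dual space is one of the form $W^*$ for some Banach space $W$. *)

(* Defs.v *)
From HB Require Import structures.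
From mathcomp Require Import all_boot all_order all_algebra.
From mathcomp Require Import boolp classical_sets functions cardinality.
From mathcomp Require Import reals ereal topology normedtype sequences.

Set Implicit Arguments.
Unset Strict Implicit.
Unset Printing Implicit Defensive.
Set Warnings "-redundant-canonical-projection,-projection-no-head-constant".

Import Order.TTheory GRing.Theory Num.Theory.
Import numFieldNormedType.Exports.

Local Open Scope classical_set_scope.
Local Open Scope ring_scope.

Section dual_space.
Context {R : realType}.

Definition continuous_linear (V : normedModType R) : {pred V -> R^o} :=
  [pred f : V -> R^o | `[< linear f /\ continuous f >]].

Lemma continuous_linear_submod_closed (V : normedModType R) :
  submod_closed (@continuous_linear V).
Proof.
split.
  apply/asboolP; split; last exact: cst_continuous.
  by move=> a x y; rewrite scaler0 addr0.
move=> k f g /asboolP[lf cf] /asboolP[lg cg]; apply/asboolP; split.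
  move=> a x y; rewrite !fctE lf lg !scalerDr !scalerA mulrC.
  by rewrite -!addrA; congr (_ + _); rewrite addrCA.
move=> x; apply: cvgD; last exact: cg.
by apply: cvgZl_tmp; exact: cf.
Qed.

HB.instance Definition _ (V : normedModType R) :=
  GRing.isSubmodClosed.Build _ _ (@continuous_linear V)
    (@continuous_linear_submod_closed V).

Record dual (V : normedModType R) := Dual {
  functional :> V -> R^o ;
  functionalP : functional \in @continuous_linear V }.

Arguments functional {V}.

HB.instance Definition _ (V : normedModType R) :=
  [isSub for @functional V].
HB.instance Definition _ (V : normedModType R) :=
  [Choice of dual V by <:].
HB.instance Definition _ (V : normedModType R) :=
  [SubChoice_isSubLmodule of dual V by <:].

Section dual_norm.
Variable V : normedModType R.
Implicit Types f g : dual V.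

Definition dual_norm f : R := sup [set `|f x| | x in [set x | `|x| <= 1]].

Lemma functional_linear f : linear f.
Proof. by have /asboolP[] := functionalP f. Qed.

Lemma functional_continuous f : continuous f.
Proof. by have /asboolP[] := functionalP f. Qed.

HB.instance Definition _ f :=
  GRing.isLinear.Build R V R^o *:%R f (@functional_linear f).

Lemma dual_norm_has_sup f : has_sup [set `|f x| | x in [set x | `|x| <= 1]].
Proof.
split; first by exists `|f 0|; exists 0 => //=; rewrite normr0 ler01.
have /linear_bounded_continuous/bounded_funP/(_ 1)[M fM] :
  continuous (f : {linear V -> R^o}) by exact: functional_continuous.
by exists M => _ [x /= x1 <-]; exact: fM.
Qed.

Lemma le_dual_norm f x : `|f x| <= dual_norm f * `|x|.
Proof.
have [->|x0] := eqVneq x 0; first by rewrite linear0 !normr0 mulr0.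
rewrite -ler_pdivrMr ?normr_gt0//.
apply: ub_le_sup; first exact: (dual_norm_has_sup f).2.
exists (`|x|^-1 *: x) => /=.
  by rewrite normrZ normfV normr_id mulVf// normr_eq0.
by rewrite linearZ/= normrZ normfV normr_id mulrC.
Qed.

Lemma dual_norm_ge0 f : 0 <= dual_norm f.
Proof.
apply: ub_le_sup; first exact: (dual_norm_has_sup f).2.
by exists 0; rewrite /= ?linear0 ?normr0.
Qed.

Lemma dual_norm_le f (M : R) : 0 <= M ->
  (forall x, `|f x| <= M * `|x|) -> dual_norm f <= M.
Proof.
move=> M0 fM; apply: ge_sup; first exact: (dual_norm_has_sup f).1.
by move=> _ [x /= x1 <-]; apply: (le_trans (fM x)); rewrite ler_piMr.
Qed.

Lemma ler_dual_normD f g : dual_norm (f + g) <= dual_norm f + dual_norm g.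
Proof.
apply: dual_norm_le => [|x]; first by rewrite addr_ge0// dual_norm_ge0.
by rewrite mulrDl (le_trans (ler_normD _ _))// lerD// le_dual_norm.
Qed.

Lemma dual_normZ (k : R) f : dual_norm (k *: f) = `|k| * dual_norm f.
Proof.
have leZ (c : R) h : dual_norm (c *: h) <= `|c| * dual_norm h.
  apply: dual_norm_le => [|x]; first by rewrite mulr_ge0// dual_norm_ge0.
  by rewrite /= fctE normrZ -mulrA ler_wpM2l// le_dual_norm.
apply/eqP; rewrite eq_le leZ/=.
have [->|k0] := eqVneq k 0; first by rewrite normr0 mul0r dual_norm_ge0.
rewrite -ler_pdivlMl ?normr_gt0// -normfV.
by rewrite -[in leLHS](scalerK k0 f) leZ.
Qed.

Lemma dual_norm0_eq0 f : dual_norm f = 0 -> f = 0.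
Proof.
move=> f0; apply/val_inj/funext => x /=; apply/eqP.
by rewrite -normr_le0 (le_trans (le_dual_norm f x))// f0 mul0r.
Qed.

HB.instance Definition _ := @Lmodule_isNormed.Build R (dual V)
  dual_norm ler_dual_normD dual_normZ dual_norm0_eq0.

End dual_norm.
End dual_space.

Section asymptotic_uniform_convexity.
Context {R : realType}.
Implicit Types V W B X : normedModType R.

Definition separable V := exists2 D : set V, countable D & dense D.

Definition lin_span V (s : seq V) : set V :=
  [set v | exists a : 'I_(size s) -> R, v = \sum_(i < size s) a i *: s`_i].

Definition infinite_dimensional V := forall s : seq V, lin_span s <> setT.

Definition subspace V (Y : set V) :=
  Y 0 /\ forall (a : R) u v, Y u -> Y v -> Y (a *: u + v).

Definition finite_codimensional V (Y : set V) :=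
  exists s : seq V, forall v, exists2 y, Y y & lin_span s (v - y).

Definition cof V : set (set V) :=
  [set Y | [/\ closed Y, subspace Y & finite_codimensional Y]].

Arguments cof : clear implicits.

(* The norm is a parameter N, so that the modulus can be taken for any
   equivalent norm on V; [cof V] only depends on the topology of V. Infima and
   suprema are those of the extended reals: no attainment or nonemptiness
   convention is needed. *)
Definition auc_modulus V (N : V -> R) (t : R) : \bar R :=
  let far (Y : set V) : set V := [set y | Y y /\ t <= N y] in
  let lower x (Y : set V) : \bar R :=
    ereal_inf [set (N (x + y))%:E | y in far Y] in
  let upper x : \bar R := ereal_sup [set lower x Y | Y in cof V] in
  (ereal_inf [set upper x | x in [set x | N x = 1%R]] - 1)%E.

Definition auc_norm V (N : V -> R) :=
  forall t : R, 0 < t -> (0 < auc_modulus N t)%E.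

Definition auc V := auc_norm (fun x : V => `|x|).

Definition equivalent_norm V (N : V -> R) :=
  [/\ forall x y, N (x + y) <= N x + N y,
      forall (a : R) x, N (a *: x) = `|a| * N x,
      forall x, N x = 0 -> x = 0 &
      exists c C : R, [/\ 0 < c, 0 < C &
        forall x, c * `|x| <= N x /\ N x <= C * `|x|]].

(* The canonical map of V into its bidual is onto. *)
Definition reflexive_space V :=
  forall phi : dual (dual V), exists x : V, forall f : dual V, phi f = f x.

Definition isometrically_isomorphic V W :=
  exists T : {linear V -> W},
    (forall x, `|T x| = `|x|) /\ (forall w, exists x, T x = w).

Definition isomorphic_to_closed_subspace B X :=
  exists T : {linear B -> X},
    [/\ continuous T, closed (range T) &
        exists2 c : R, 0 < c & forall x, c * `|x| <= `|T x|].

Definition in_l2_sum (E : nat -> normedModType R) (y : forall n, E n) :=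
  cvgn (series (fun n => `|y n| ^+ 2 : R)).

Definition l2_sum_norm (E : nat -> normedModType R) (y : forall n, E n) : R :=
  Num.sqrt (limn (series (fun n => `|y n| ^+ 2 : R))).

(* X is isometrically isomorphic to the l2-sum of the E n, the isomorphism being
   given by its (linear) coordinates T n. *)
Definition is_l2_sum X (E : nat -> normedModType R) :=
  exists T : forall n, {linear X -> E n},
    (forall x, in_l2_sum (fun n => T n x) /\
               l2_sum_norm (fun n => T n x) = `|x|) /\
    (forall y : forall n, E n, in_l2_sum y -> exists x, forall n, T n x = y n).

End asymptotic_uniform_convexity.

(* Standing convention: Banach spaces are real, separable and infinite
   dimensional. *)
Definition banach {R : realType} (X : completeNormedModType R) :=
  separable X /\ infinite_dimensional X.

Definition dual_banach {R : realType} (X : completeNormedModType R) :=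
  exists W : completeNormedModType R,
    banach W /\ isometrically_isomorphic X (dual W).

Definition C_auc {R : realType} (B : completeNormedModType R) :=
  [/\ banach B, reflexive_space B &
      exists N : B -> R, equivalent_norm N /\ auc_norm N].

Definition universal_for {R : realType} (X : completeNormedModType R)
    (C : completeNormedModType R -> Prop) :=
  forall B : completeNormedModType R,
    C B -> isomorphic_to_closed_subspace B X.

(* Main.v *)
(* Let B be a separable reflexive space with an equivalent a.u.c. norm N. Weak
   compactness of the unit ball makes the dual norm asymptotically uniformly
   smooth: a functional h that is small on finitely many suitable points Z(g)
   satisfies ||g + h|| <= ||g|| + 1/2 once ||g|| is large and ||h|| <= 2. Choose
   inductively finite test sets Z_0, Z_1, ... in B and finite sets S_l of
   functionals of norm at most 1, where Z_(l+1) is suitable for all short sums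
   of differences of elements of S_0, ..., S_(l-1), and S_l is a net of the dual
   ball for the evaluations on Z_(l+1). A norming functional f is then the end
   of a walk v_0 = 0, v_1, ..., v_n = f with v_(l+1) in S_l, each move being
   small on the current test set. Differences of such walks over disjoint
   intervals, even over different walks, form blocks for which the sum of 2r
   blocks has at most half of the trivial norm. Iterating this, the number of
   blocks h with |h(b)| > 2^(1-k) N(b) is at most 2 (2r)^k, so that
   sum |h(b)|^q <= C N(b)^q when q is large.

   The walks form a finitely branching tree, which is part of a fixed universal
   tree: a move also records the size of S_l, and nodes are ranked so that the
   nodes over B at a given depth have the same rank. Reading b along the tree
   embeds B into the space E_q of functions on the universal tree normed by the
   smallest set of functionals containing the segments of branches and stable
   under (1 - v^q) f + v^(q-1) g, for f supported below g in rank. This stability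
   is what makes E_q a.u.c. Only finite dimensional information enters the tree,
   so countably many spaces E_q suffice. Being normed by finitely supported
   functionals, their l2-sum is the dual of the closed span of the coordinates. *)

From HB Require Import structures.
Require Import Defs.
From mathcomp Require Import all_boot all_order all_algebra.
From mathcomp Require Import zify ring lra.
From mathcomp Require Import boolp classical_sets functions cardinality.
From mathcomp Require Import reals ereal topology normedtype sequences.

Set Implicit Arguments.
Unset Strict Implicit.
Unset Printing Implicit Defensive.
Set Warnings "-redundant-canonical-projection,-projection-no-head-constant".

Import Order.TTheory GRing.Theory Num.Theory.
Import numFieldNormedType.Exports.

Local Open Scope classical_set_scope.
Local Open Scope ring_scope.

(** * Spaces of functions normed by finitely supported functionals *)

Section pairing.
Context {R : realType} {S : Type}.
Implicit Types (z w : seq (R * S)) (x y : S -> R) (a : R).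

(** A list is a formal linear combination of point evaluations, in which a point may occur several
    times; functionals are compared through their pairings. *)
Definition pairing z x : R := \sum_(p <- z) p.1 * x p.2.

Lemma pairing_nil x : pairing [::] x = 0.
Proof. by rewrite /pairing big_nil. Qed.

Lemma pairing1 a s x : pairing [:: (a, s)] x = a * x s.
Proof. by rewrite /pairing big_seq1. Qed.

Lemma pairing_cons p z x : pairing (p :: z) x = p.1 * x p.2 + pairing z x.
Proof. by rewrite /pairing big_cons. Qed.

Lemma pairing_cat z w x : pairing (z ++ w) x = pairing z x + pairing w x.
Proof. by rewrite /pairing big_cat. Qed.

Definition scale_seq a z : seq (R * S) := [seq (a * p.1, p.2) | p <- z].

Lemma pairing_scale a z x : pairing (scale_seq a z) x = a * pairing z x.
Proof.
rewrite /pairing big_map mulr_sumr; apply: eq_bigr => p _ /=.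
by rewrite mulrA.
Qed.

Lemma pairingD z x y : pairing z (x + y) = pairing z x + pairing z y.
Proof.
rewrite /pairing -big_split /=; apply: eq_bigr => p _.
by rewrite fctE mulrDr.
Qed.

Lemma pairingZ z a x : pairing z (a *: x) = a * pairing z x.
Proof.
rewrite /pairing mulr_sumr; apply: eq_bigr => p _.
by rewrite fctE mulrCA.
Qed.

Lemma pairing0 z : pairing z 0 = 0.
Proof. by rewrite -(scale0r (0 : S -> R)) pairingZ mul0r. Qed.

Lemma pairingN z x : pairing z (- x) = - pairing z x.
Proof. by rewrite -scaleN1r pairingZ mulN1r. Qed.

Lemma pairingB z x y : pairing z (x - y) = pairing z x - pairing z y.
Proof. by rewrite pairingD pairingN. Qed.

Lemma eq_pairing z x y : x =1 y -> pairing z x = pairing z y.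
Proof. by move=> /funext ->. Qed.

End pairing.

Section norming_space.
Context {R : realType}.

(* [nK] is a norming set of finitely supported functionals; [nP] cuts out a
   closed subspace of the space of all [nK]-bounded functions. *)
Record norming (S : Type) := Norming {
  nK : set (seq (R * S)) ;
  nP : set (S -> R) ;
  nK_nil : nK [::] ;
  nK_coord : forall s, exists2 c : R, 0 < c & nK [:: (c, s)] ;
  nP_submod : submod_closed [pred f | `[< nP f >]] ;
  nP_closed : forall f, (forall e : R, 0 < e -> exists2 g, nP g &
    forall z, nK z -> `|pairing z (f - g)| <= e) -> nP f }.

Variables (S : Type) (D : norming S).

Definition nbounded (f : S -> R) :=
  exists M : R, forall z, nK D z -> `|pairing z f| <= M.

Definition npred : {pred S -> R} := [pred f | `[< nP D f /\ nbounded f >]].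

Lemma npred_submod_closed : submod_closed npred.
Proof.
have [P0 PD] := nP_submod D.
split.
  apply/asboolP; split; first by move/asboolP : P0.
  by exists 0 => z _; rewrite pairing0 normr0.
move=> a f g /asboolP[Pf [M fM]] /asboolP[Pg [M' gM]]; apply/asboolP; split.
  by have /asboolP := PD a f g (asboolT Pf) (asboolT Pg).
exists (`|a| * M + M') => z Kz; rewrite pairingD pairingZ.
by rewrite (le_trans (ler_normD _ _))// lerD ?gM// normrM ler_wpM2l// fM.
Qed.

HB.instance Definition _ :=
  GRing.isSubmodClosed.Build _ _ npred npred_submod_closed.

Record nspace := NSpace { nfun :> S -> R ; nfunP : nfun \in npred }.

HB.instance Definition _ := [isSub for nfun].
HB.instance Definition _ := [Choice of nspace by <:].
HB.instance Definition _ := [SubChoice_isSubLmodule of nspace by <:].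

Implicit Types f g : nspace.

Definition nnorm f : R := sup [set `|pairing z f| | z in nK D].

Lemma nnorm_has_sup f : has_sup [set `|pairing z f| | z in nK D].
Proof.
split; first by exists `|pairing [::] f|; exists [::] => //; exact: nK_nil.
have /asboolP[_ [M fM]] := nfunP f.
by exists M => _ [z /= Kz <-]; exact: fM.
Qed.

Lemma le_nnorm f z : nK D z -> `|pairing z f| <= nnorm f.
Proof.
by move=> Kz; apply: ub_le_sup; [exact: (nnorm_has_sup f).2|exists z].
Qed.

Lemma nnorm_le f (M : R) :
  (forall z, nK D z -> `|pairing z f| <= M) -> nnorm f <= M.
Proof.
move=> fM; apply: ge_sup; first exact: (nnorm_has_sup f).1.
by move=> _ [z /= Kz <-]; exact: fM.
Qed.

Lemma nnorm_gtP f (M : R) : M < nnorm f ->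
  exists2 z, nK D z & M < `|pairing z f|.
Proof.
by move=> /(sup_gt (nnorm_has_sup f).1)[_ [z Kz <-] Mz]; exists z.
Qed.

Lemma nnorm_ge0 f : 0 <= nnorm f.
Proof. by have := le_nnorm f (nK_nil D); rewrite pairing_nil normr0. Qed.

Lemma ler_nnormD f g : nnorm (f + g) <= nnorm f + nnorm g.
Proof.
apply: nnorm_le => z Kz.
by rewrite pairingD (le_trans (ler_normD _ _))// lerD// le_nnorm.
Qed.

Lemma nnormZ (a : R) f : nnorm (a *: f) = `|a| * nnorm f.
Proof.
have leZ (c : R) h : nnorm (c *: h) <= `|c| * nnorm h.
  by apply: nnorm_le => z Kz; rewrite pairingZ normrM ler_wpM2l// le_nnorm.
apply/eqP; rewrite eq_le leZ/=.
have [->|a0] := eqVneq a 0; first by rewrite normr0 mul0r nnorm_ge0.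
rewrite -ler_pdivlMl ?normr_gt0// -normfV.
by rewrite -[in leLHS](scalerK a0 f) leZ.
Qed.

Lemma nfun_bound s : exists2 C : R, 0 < C & forall f, `|f s| <= C * nnorm f.
Proof.
have [c c0 Kc] := nK_coord D s; exists c^-1; rewrite ?invr_gt0// => f.
by rewrite ler_pdivlMl// -{1}(gtr0_norm c0) -normrM -pairing1 le_nnorm.
Qed.

Lemma nnorm0_eq0 f : nnorm f = 0 -> f = 0.
Proof.
move=> f0; apply/val_inj/funext => s /=; apply/eqP.
by have [C _ /(_ f)] := nfun_bound s; rewrite f0 mulr0 normr_le0.
Qed.

HB.instance Definition _ := @Lmodule_isNormed.Build R nspace
  nnorm ler_nnormD nnormZ nnorm0_eq0.

(** Coordinates are bounded functionals, so a Cauchy filter has a pointwise limit. Pairings are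
    finite sums and pass to this limit, which gives closeness uniformly over [nK]; [nP_closed] then
    puts the limit in the space. *)
Lemma nspace_cauchy_cvg (F : set_system nspace) :
  ProperFilter F -> cauchy F -> cvg F.
Proof.
move=> FF Fc.
have close (e : R) : 0 < e ->
    exists2 A, F A & forall f g, A f -> A g -> `|f - g| <= e.
  move=> e0; have e2 : 0 < e / 2 by rewrite divr_gt0.
  have [f0 Ff0] := (cauchyP F).1 Fc _ e2.
  exists (ball f0 (e / 2)) => // f g; rewrite -ball_normE /= => f0f f0g.
  rewrite (splitr e) -(subrKA f0) (le_trans (ler_normD _ _))//.
  by rewrite lerD// ltW// distrC.
have Cs s : cvg ((fun f : nspace => f s : R) @ F).
  have [C C0 fC] := nfun_bound s.
  apply: cauchy_cvg; apply: cauchy_exP => e e0.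
  have [A FA Ae] := close (e / C / 2) ltac:(by rewrite !divr_gt0).
  have [f Af] := filter_ex FA; exists (f s).
  suff : \forall h \near F, ball (f s) e (nfun h s) by [].
  near=> h; rewrite /= -ball_normE /=.
  apply: (@le_lt_trans _ _ (e / 2)); last by rewrite gtr_pMr// invf_lt1// ltr1n.
  have -> : f s - h s = (f - h) s by [].
  rewrite (le_trans (fC _))// mulrC -ler_pdivlMr//.
  rewrite (le_trans (Ae f h _ _))//; first by near: h.
  by rewrite mulrAC.
pose g s : R := lim ((fun f : nspace => f s : R) @ F).
have Cz z : (fun f : nspace => pairing z f) @ F --> pairing z g.
  elim: z => [|p z IH].
    rewrite pairing_nil; under eq_fun do rewrite pairing_nil; exact: cvg_cst.
  rewrite pairing_cons; under eq_fun do rewrite pairing_cons.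
  by apply: cvgD => //; apply: cvgZr; exact: Cs.
have gA (e : R) A f : 0 < e -> F A -> (forall f g, A f -> A g -> `|f - g| <= e) ->
    A f -> forall z, nK D z -> `|pairing z f - pairing z g| <= e.
  move=> e0 FA Ae Af z Kz.
  have : (fun h : nspace => `|pairing z f - pairing z h|) @ F -->
      `|pairing z f - pairing z g|.
    by apply: cvg_norm; apply: cvgB; [exact: cvg_cst|exact: Cz].
  move=> cv; suff ne : \forall h \near F, `|pairing z f - pairing z (nfun h)| <= e.
    exact: (@closed_cvg _ _ _ _ _ _ (@closed_le R e) ne _ cv).
  near=> h; rewrite -pairingB (le_trans _ (Ae f h _ _))//; last by near: h.
  exact: (le_nnorm (f - h) Kz).
have gP : g \in npred.
  apply/asboolP; split.
    apply: nP_closed => e e0; have [A FA Ae] := close e e0.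
    have [f Af] := filter_ex FA.
    exists f => [|z Kz]; first by have /asboolP[] := nfunP f.
    by rewrite pairingB distrC (gA e A f).
  have [A FA Ae] := close 1 ltr01; have [f Af] := filter_ex FA.
  exists (nnorm f + 1) => z Kz.
  rewrite -(subrK (pairing z f) (pairing z g)) addrC.
  by rewrite (le_trans (ler_normD _ _))// lerD ?le_nnorm// distrC (gA 1 A f).
apply/cvg_ex; exists (NSpace gP); apply/cvgrPdist_le => e e0.
have [A FA Ae] := close e e0.
near=> f; rewrite distrC; apply: nnorm_le => z Kz.
by rewrite pairingB (gA e A f)//; near: f.
Unshelve. all: by end_near. Qed.

HB.instance Definition _ := Uniform_isComplete.Build nspace nspace_cauchy_cvg.

End norming_space.

(** * Preduals *)

Section functionals.
Context {R : realType}.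

Lemma bounded_functional (V : normedModType R) (f : V -> R^o) (M : R) :
  linear f -> (forall x, `|f x| <= M * `|x|) ->
  exists F : dual V, forall x, F x = f x.
Proof.
move=> lf fM; pose g : {linear V -> R^o} :=
  HB.pack_for {linear V -> R^o} f (GRing.isLinear.Build R V R^o *:%R f lf).
have cf : continuous f.
  have : continuous (g : V -> R^o).
    apply/linear_bounded_continuous/bounded_funP => r; exists (`|M| * r) => x xr.
    rewrite /= (le_trans (fM x))// (le_trans (ler_norm _))// normrM normr_id.
    by rewrite ler_wpM2l.
  by [].
have fP : f \in @continuous_linear R V by apply/asboolP.
by exists (Dual fP).
Qed.

Lemma bounded_linear_map (V W : normedModType R) (f : {linear V -> W}) (M : R) :
  (forall x, `|f x| <= M * `|x|) -> continuous f.
Proof.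
move=> fM; apply/linear_bounded_continuous/bounded_funP => r.
exists (`|M| * r) => x xr.
rewrite /= (le_trans (fM x))// (le_trans (ler_norm _))// normrM normr_id.
by rewrite ler_wpM2l.
Qed.

End functionals.

Section predual.
Context {R : realType} {S : Type}.
Variable D : @norming R S.
Hypothesis D_full : nP D = setT.
Let X := nspace D.

(** The predual is again a normed function space, now of functions on [X]. One-point functionals of
    this size produce the supremum of [|phi x| / |x|] as norm. *)
Definition predual_K : set (seq (R * X)) :=
  [set z | z = [::] \/ exists c x, [/\ 0 <= c, c * `|x| <= 1 & z = [:: (c, x)]]].

(** The closed linear span of the coordinate functionals in the dual of [X]; linearity of its
    members is derived in [predual_linear]. *)
Definition predual_P : set (X -> R) :=
  [set phi | forall e : R, 0 < e -> exists w : seq (R * S), forall x : X,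
    `|phi x - pairing w x| <= e * `|x|].

Lemma predual_K_nil : predual_K [::]. Proof. by left. Qed.

Lemma predual_K_coord x : exists2 c : R, 0 < c & predual_K [:: (c, x)].
Proof.
exists (1 + `|x|)^-1; first by rewrite invr_gt0 ltr_pwDl.
right; exists (1 + `|x|)^-1, x; split=> //.
by rewrite ler_pdivrMl ?ltr_pwDl// mulr1 lerDr.
Qed.

Lemma predual_P_submod : submod_closed [pred f | `[< predual_P f >]].
Proof.
split.
  by apply/asboolP => e e0; exists [::] => x; rewrite pairing_nil subrr normr0 mulr_ge0// ltW.
move=> a f g /asboolP Pf /asboolP Pg; apply/asboolP => e e0.
have a0 : 0 < `|a| + 1 by rewrite ltr_pwDr.
have [w fw] := Pf (e / 2 / (`|a| + 1)) ltac:(by rewrite !divr_gt0).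
have [w' gw] := Pg (e / 2) ltac:(by rewrite !divr_gt0).
exists (scale_seq a w ++ w') => x; rewrite pairing_cat pairing_scale.
have -> : (a *: f + g) x - (a * pairing w x + pairing w' x) =
  a * (f x - pairing w x) + (g x - pairing w' x).
  rewrite [LHS]/= -[(a *: f + g) x]/(a * f x + g x); ring.
rewrite (splitr e) mulrDl (le_trans (ler_normD _ _))// lerD//.
rewrite normrM (le_trans (ler_wpM2l (normr_ge0 _) (fw x)))// mulrA ler_wpM2r//.
by rewrite mulrA ler_pdivrMr// mulrC ler_wpM2l ?lerDl// ltW// divr_gt0.
Qed.

Lemma predual_K_bound (f : X -> R) (e : R) :
  (forall z, predual_K z -> `|pairing z f| <= e) ->
  forall x, `|f x| <= e * `|x|.
Proof.
move=> fe x; have [x0|x0] := eqVneq `|x| 0.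
  rewrite x0 mulr0 leNgt; apply/negP => fx0.
  (* When [|x|] vanishes, every nonnegative coefficient is allowed at [x]; this one gives the
     pairing absolute value [|e| + 1], which exceeds [e]. *)
  have := fe [:: ((`|e| + 1) / `|f x|, x)].
  rewrite pairing1 normrM ger0_norm; last by rewrite mulr_ge0// ?invr_ge0// addr_ge0.
  rewrite mulfVK ?gt_eqF// => /(_ _)/wrap[].
    by right; do 2 eexists; split; last reflexivity;
      rewrite ?x0 ?mulr0// mulr_ge0// ?invr_ge0// addr_ge0.
  by apply/negP; rewrite -ltNge (le_lt_trans (ler_norm _))// ltrDl.
have xp : 0 < `|x| by rewrite lt_def x0 normr_ge0.
rewrite -ler_pdivrMr// mulrC.
have := fe [:: (`|x|^-1, x)]; rewrite pairing1 normrM normfV normr_id; apply.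
by right; exists `|x|^-1, x; rewrite mulVf// invr_ge0.
Qed.

Lemma predual_P_closed (f : X -> R) : (forall e : R, 0 < e ->
    exists2 g, predual_P g &
      forall z, predual_K z -> `|pairing z (f - g)| <= e) -> predual_P f.
Proof.
move=> fP e e0; have e2 : 0 < e / 2 by rewrite divr_gt0.
have [g Pg /predual_K_bound fg] := fP _ e2; have [w gw] := Pg _ e2.
exists w => x; rewrite -(subrKA (g x)) (splitr e) mulrDl.
by rewrite (le_trans (ler_normD _ _))// lerD//; exact: fg.
Qed.

Definition predual : @norming R X := Norming predual_K_nil predual_K_coord
  predual_P_submod predual_P_closed.

Let W := nspace predual.

Lemma predual_apply_le (phi : W) (x : X) : `|phi x| <= `|phi| * `|x|.
Proof. by apply: predual_K_bound => z Kz; exact: le_nnorm. Qed.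

Lemma predual_norm_le (phi : W) (M : R) : 0 <= M ->
  (forall x, `|phi x| <= M * `|x|) -> `|phi| <= M.
Proof.
move=> M0 phiM; apply: nnorm_le => z [->|[c [x [c0 cx ->]]]].
  by rewrite pairing_nil normr0.
rewrite pairing1 normrM (ger0_norm c0) (le_trans (ler_wpM2l c0 (phiM x)))//.
by rewrite mulrCA ler_piMr.
Qed.

Lemma pairing_predualP (w : seq (R * S)) : (fun x : X => pairing w x) \in npred predual.
Proof.
apply/asboolP; split.
  by move=> e e0; exists w => x; rewrite subrr normr0 mulr_ge0// ltW.
have [M M0 wM] : exists2 M : R, 0 <= M & forall x : X, `|pairing w x| <= M * `|x|.
  elim: w => [|p w [M M0 wM]].
    by exists 0 => // x; rewrite pairing_nil normr0 mul0r.
  have [C C0 pC] := nfun_bound D p.2.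
  exists (`|p.1| * C + M) => [|x].
    by rewrite addr_ge0// mulr_ge0// ltW.
  rewrite pairing_cons mulrDl (le_trans (ler_normD _ _))// lerD// normrM.
  by rewrite -mulrA ler_wpM2l//; exact: pC.
exists M => z [->|[c [x [c0 cx ->]]]]; first by rewrite pairing_nil normr0.
rewrite pairing1 normrM (ger0_norm c0) (le_trans (ler_wpM2l c0 (wM x)))//.
by rewrite mulrCA ler_piMr.
Qed.

Definition predual_pairing w : W := NSpace (pairing_predualP w).

Lemma predual_pairing_le1 w : nK D w -> `|predual_pairing w| <= 1.
Proof.
by move=> Kw; apply: predual_norm_le => // x; rewrite mul1r; exact: le_nnorm.
Qed.

Lemma predual_approx (phi : W) (e : R) : 0 < e ->
  exists w, `|phi - predual_pairing w| <= e.
Proof.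
move=> e0; have /asboolP[/(_ e e0)[w phiw] _] := nfunP phi.
by exists w; apply: predual_norm_le => //; exact: ltW.
Qed.

(** Up to [e / C] times the norm, [phi] is a pairing, hence linear. The errors at the three vectors
    involved add up to at most [e] by the choice of [C]. *)
Lemma predual_linear (phi : W) : linear (phi : X -> R^o).
Proof.
move=> a x y; apply/eqP; rewrite -subr_eq0 -normr_le0; apply/ler_addgt0Pl => e e0.
rewrite addr0; pose C := `|a *: x + y| + `|a| * `|x| + `|y| + 1.
have C0 : 0 < C by rewrite ltr_pwDr// !addr_ge0// mulr_ge0.
have /asboolP[/(_ (e / C) (divr_gt0 e0 C0))[w phiw] _] := nfunP phi.
have -> : (phi : X -> R^o) (a *: x + y) - (a *: (phi x : R^o) + phi y) =
  (phi (a *: x + y) - pairing w (a *: x + y)) -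
  a * (phi x - pairing w x) - (phi y - pairing w y).
  have -> : pairing w (a *: x + y) = a * pairing w x + pairing w y.
    by rewrite -pairingZ -pairingD.
  have -> : a *: (phi x : R^o) = a * phi x by [].
  by ring.
rewrite (le_trans (ler_normB _ _))// (le_trans (lerD (ler_normB _ _) (lexx _)))//.
rewrite normrM (le_trans (lerD (lerD (phiw _) (ler_wpM2l _ (phiw x))) (phiw y)))//.
have -> : e / C * `|a *: x + y| + `|a| * (e / C * `|x|) + e / C * `|y| =
  e / C * (C - 1) by rewrite /C; ring.
rewrite mulrAC ler_pdivrMr// ler_wpM2l ?ltW//; lra.
Qed.

Lemma predual_evalP (x : X) : exists F : dual W, forall phi : W, F phi = phi x.
Proof.
apply: (@bounded_functional _ _ (fun phi : W => phi x) `|x|) => [a f g //|phi].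
by rewrite mulrC; exact: predual_apply_le.
Qed.

Definition predual_eval (x : X) : dual W := projT1 (cid (predual_evalP x)).

Lemma predual_evalE x phi : predual_eval x phi = phi x.
Proof. by rewrite /predual_eval; case: cid. Qed.

Lemma predual_eval_linear : linear predual_eval.
Proof.
move=> a x y; apply/val_inj/funext => phi /=.
rewrite fctE predual_evalE predual_linear -[in RHS]/(functional _ _).
by rewrite /= !fctE !predual_evalE.
Qed.

HB.instance Definition _ :=
  GRing.isLinear.Build R X (dual W) *:%R predual_eval predual_eval_linear.

Lemma norm_predual_eval x : `|predual_eval x| = `|x|.
Proof.
apply/eqP; rewrite eq_le; apply/andP; split.
  apply: dual_norm_le => // phi.
  by rewrite predual_evalE mulrC; exact: predual_apply_le.
apply: nnorm_le => z Kz.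
have := le_dual_norm (predual_eval x) (predual_pairing z).
rewrite predual_evalE => /le_trans; apply.
by rewrite ler_piMr ?predual_pairing_le1//; exact: dual_norm_ge0.
Qed.

(** The values of [Phi] on the coordinates form a function [x0] bounded on [nK]. As [nP D] is
    everything, [x0] lies in [X]; evaluation at [x0] agrees with [Phi] on the pairings, which are
    dense. *)
Lemma predual_eval_surj (Phi : dual W) : exists x, predual_eval x = Phi.
Proof.
pose x0 (s : S) : R := Phi (predual_pairing [:: (1, s)]).
have Phi_pairing w : Phi (predual_pairing w) = pairing w x0.
  elim: w => [|[a s] w IH].
    rewrite pairing_nil.
    have -> : predual_pairing [::] = 0.
      by apply/val_inj/funext => x /=; rewrite pairing_nil.
    exact: linear0.
  have -> : predual_pairing ((a, s) :: w) =
      a *: predual_pairing [:: (1, s)] + predual_pairing w.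
    apply/val_inj/funext => x /=.
    by rewrite fctE pairing_cons /= fctE -[a *: _]/(a * _) pairing1 mul1r.
  by rewrite linearD linearZ/= IH pairing_cons.
have x0P : x0 \in npred D.
  apply/asboolP; rewrite D_full; split=> //; exists (dual_norm Phi) => z Kz.
  rewrite -Phi_pairing (le_trans (le_dual_norm _ _))//.
  by rewrite ler_piMr ?predual_pairing_le1//; exact: dual_norm_ge0.
exists (NSpace x0P); apply/val_inj/funext => phi /=.
rewrite -/(predual_eval _ phi) predual_evalE; set x := NSpace x0P.
apply/eqP; rewrite -subr_eq0 -normr_le0; apply/ler_addgt0Pl => e e0.
rewrite addr0; pose C := `|x| + dual_norm Phi + 1.
have C0 : 0 < C by rewrite ltr_pwDr// addr_ge0// dual_norm_ge0.
have [w phiw] := predual_approx phi (divr_gt0 e0 C0).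
have -> : phi x - Phi phi = (phi - predual_pairing w) x - Phi (phi - predual_pairing w).
  have -> : (phi - predual_pairing w) x = phi x - pairing w x0 by [].
  by rewrite linearB/= Phi_pairing opprB addrA subrK.
rewrite (le_trans (ler_normB _ _))//.
rewrite (le_trans (lerD (predual_apply_le _ _) (le_dual_norm _ _)))//.
rewrite mulrC -mulrDl.
apply: (@le_trans _ _ ((`|x| + dual_norm Phi) * (e / C))).
  by rewrite ler_wpM2l// addr_ge0// dual_norm_ge0.
rewrite mulrA ler_pdivrMr// mulrC; apply: ler_wpM2l; first exact: ltW.
by rewrite /C lerDl.
Qed.

Lemma predual_isometry : isometrically_isomorphic X (dual W).
Proof.
exists (predual_eval : {linear X -> dual W}); split.
  exact: norm_predual_eval.
exact: predual_eval_surj.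
Qed.

End predual.

(** * Criteria for separability and for infinite dimension *)

Section separability.
Context {R : realType}.

Lemma separable_span (S : countType) (V : normedModType R) (e : S -> V) :
  (forall (x : V) (d : R), 0 < d ->
    exists w : seq (R * S), `|x - \sum_(p <- w) p.1 *: e p.2| <= d) ->
  separable V.
Proof.
move=> eV; pose F (w : seq (rat * S)) : V := \sum_(p <- w) ratr p.1 *: e p.2.
exists (range F); first exact: card_le_trans (card_image_le _ _) (countableP _).
move=> U [x Ux] Uo; have /nbhs_ballP[d /= d0 dU] := open_nbhs_nbhs (conj Uo Ux).
have [w xw] := eV x (d / 4) ltac:(by rewrite divr_gt0).
have [w' ww'] : exists w' : seq (rat * S),
    `|\sum_(p <- w) p.1 *: e p.2 - F w'| <= d / 4.
  have : 0 < d / 4 by rewrite divr_gt0.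
  move: (d / 4) => {xw dU d0 d} d.
  elim: w d => [|[a s] w IH] d d0.
    by exists [::]; rewrite /F !big_nil subrr normr0 ltW.
  have [w' ww'] := IH (d / 2) ltac:(by rewrite divr_gt0).
  have C0 : 0 < `|e s| + 1 by rewrite ltr_wpDl.
  have /rat_in_itvoo[q] : a - d / 2 / (`|e s| + 1) < a + d / 2 / (`|e s| + 1).
    by rewrite ltrBlDr -addrA ltrDl addr_gt0// !divr_gt0.
  rewrite in_itv /= => /andP[qa1 qa2].
  exists ((q, s) :: w'); rewrite /F !big_cons /= opprD addrACA -scalerBl.
  rewrite (splitr d) (le_trans (ler_normD _ _))// lerD// normrZ.
  have aq : `|a - ratr q| <= d / 2 / (`|e s| + 1).
    by rewrite distrC ler_distl !ltW.
  rewrite (le_trans (ler_wpM2r (normr_ge0 _) aq))// mulrAC ler_pdivrMr//.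
  by rewrite ler_wpM2l ?lerDl// ltW// divr_gt0.
exists (F w'); split; last by exists w'.
apply: dU; rewrite -ball_normE /=.
rewrite -(subrKA (\sum_(p <- w) p.1 *: e p.2)).
rewrite (le_lt_trans (ler_normD _ _))// (le_lt_trans (lerD xw ww'))//.
lra.
Qed.

(** If [n] vectors spanned the space, the identity matrix of size [n + 1] would factor through
    dimension [n], against its rank. *)
Lemma biorthogonal_infinite_dimensional (V : normedModType R)
    (v : nat -> V) (phi : nat -> V -> R) :
  (forall n (a : R) x y, phi n (a *: x + y) = a * phi n x + phi n y) ->
  (forall i j, phi i (v j) = (i == j)%:R) ->
  infinite_dimensional V.
Proof.
move=> phil phiv s sV; set n := size s.
have /choice[a va] (i : 'I_n.+1) : exists a : 'I_n -> R, v i = \sum_(j < n) a j *: s`_j.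
  by have : lin_span s (v i) by rewrite sV.
have phi0 k : phi k 0 = 0.
  by have := phil k 1 0 0; rewrite scaler0 addr0 mul1r => /esym/eqP; rewrite -subr_eq0 addrK => /eqP.
have phi_sum k (c : 'I_n -> R) : phi k (\sum_(j < n) c j *: s`_j) = \sum_(j < n) c j * phi k s`_j.
  elim/big_rec2: _ => [//|j x y _ <-]; exact: phil.
pose A := \matrix_(i < n.+1, j < n) a i j.
pose B := \matrix_(j < n, k < n.+1) phi k s`_j.
have AB : A *m B = 1%:M.
  apply/matrixP => i k; rewrite !mxE -[RHS]/((i == k)%:R) eq_sym.
  rewrite -[k == i]/((k : nat) == i) -phiv va phi_sum.
  by apply: eq_bigr => j _; rewrite !mxE.
have := mxrankM_maxl A B; rewrite AB mxrank1 => /leq_trans/(_ (rank_leq_col A)).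
by rewrite ltnn.
Qed.

End separability.

(** * The tree spaces *)

Section tree.
Context {R : realType}.

(** In the embedding, the first entry of a letter selects a move and the second pads it, so that the
    sum of both plus one is the number of available moves. *)
Definition word := seq (nat * nat).

(* The node [(s, c)] stands for the nonempty word [rcons s c]. *)
Definition node := (word * (nat * nat))%type.

(* Only finitely many nodes have a given rank. *)
Definition rank (s : word) : nat := \sum_(c <- s) (c.1 + c.2).+1.

Definition nrank (p : node) : nat := rank (rcons p.1 p.2).

Definition word_node (s : word) (l : nat) : node := (take l s, nth (0, 0)%N s l).

(** Unit coefficients make the pairing with the increments of a walk telescope along a branch. *)
Definition segment (s : word) (a b : nat) : seq (R * node) :=
  [seq (1, word_node s l) | l <- iota a (b - a)].

Lemma rank_rcons s c : rank (rcons s c) = (rank s + (c.1 + c.2).+1)%N.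
Proof. by rewrite /rank big_rcons /= addnC. Qed.

Lemma nrank_word_node s l : (l < size s)%N -> nrank (word_node s l) = rank (take l.+1 s).
Proof. by move=> ls; rewrite /nrank /= -take_nth. Qed.

Lemma leq_rank_take s a b : (a <= b)%N -> (rank (take a s) <= rank (take b s))%N.
Proof.
move=> ab; have [k ->] : exists k, b = (a + k)%N by exists (b - a)%N; rewrite subnKC.
elim: k => [|k IH]; first by rewrite addn0.
rewrite addnS (leq_trans IH)//; have [ks|ks] := ltnP (a + k) (size s).
  by rewrite (take_nth (0, 0)%N ks) rank_rcons leq_addr.
by rewrite !take_oversize// (leq_trans ks).
Qed.

Lemma segment_nil s a b : (b <= a)%N -> segment s a b = [::].
Proof. by rewrite -subn_eq0 /segment => /eqP ->. Qed.

Lemma segment_cons s a b : (a < b)%N ->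
  segment s a b = (1, word_node s a) :: segment s a.+1 b.
Proof.
move=> ab; rewrite /segment.
by have -> : (b - a = (b - a.+1).+1)%N by rewrite subnSK.
Qed.

Variable r : nat.

(* [treeK m n z]: [z] is a functional in the norming set, supported by nodes of
   rank in [m, n). *)
Inductive treeK : nat -> nat -> seq (R * node) -> Prop :=
| treeK_nil m n : (m <= n)%N -> treeK m n [::]
| treeK_neg m n z : treeK m n z -> treeK m n (scale_seq (-1) z)
| treeK_segment m n s a b : (m <= n)%N -> (a < b)%N -> (b <= size s)%N ->
    (m <= rank (take a.+1 s))%N -> (rank (take b s) < n)%N ->
    treeK m n (segment s a b)
| treeK_join m n l f g (v : R) : treeK m n f -> treeK n l g -> 0 <= v <= 1 ->
    treeK m l (scale_seq (1 - v ^+ r.+2) f ++ scale_seq (v ^+ r.+1) g).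

Lemma treeK_leq m n z : treeK m n z -> (m <= n)%N.
Proof. by elim=> // {}m {}n l f g v _ mn _ nl _; exact: leq_trans nl. Qed.

Lemma treeK_widen m n m' n' z : treeK m n z ->
  (m' <= m)%N -> (n <= n')%N -> treeK m' n' z.
Proof.
move=> Kz; elim: Kz m' n' => {m n z}.
- move=> m n mn m' n' m'm nn'; apply: treeK_nil.
  by rewrite (leq_trans m'm)// (leq_trans mn).
- by move=> m n z _ IH m' n' m'm nn'; apply: treeK_neg; exact: IH.
- move=> m n s a b mn ab bs ma bn m' n' m'm nn'; apply: treeK_segment => //.
  + by rewrite (leq_trans m'm)// (leq_trans mn).
  + exact: leq_trans ma.
  + exact: leq_trans nn'.
- move=> m n l f g v Kf IHf Kg IHg v01 m' n' m'm nn'.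
  by apply: (@treeK_join _ n) => //; [exact: IHf|exact: IHg].
Qed.

Lemma treeK_support m n z : treeK m n z ->
  forall p, p \in z -> (m <= nrank p.2 < n)%N.
Proof.
elim=> {m n z}.
- by [].
- by move=> m n z _ IH p' /mapP[p pz ->]; exact: (IH _ pz).
- move=> m n s a b mn ab bs ma bn p /mapP[l]; rewrite mem_iota => /andP[al lb] ->.
  have {}lb : (l < b)%N by rewrite subnKC in lb; last exact: ltnW.
  rewrite nrank_word_node; last exact: leq_trans bs.
  by rewrite (leq_trans ma) ?leq_rank_take// (leq_ltn_trans _ bn)// leq_rank_take.
- move=> m n l f g v Kf IHf Kg IHg _ p; rewrite mem_cat => /orP[] /mapP[p' p'z ->].
    have /andP[-> /= /leq_trans] := IHf _ p'z; apply; exact: treeK_leq Kg.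
  by have /andP[/(leq_trans (treeK_leq Kf)) -> ->] := IHg _ p'z.
Qed.

Definition tail_fun (n : nat) (x : node -> R) (p : node) : R :=
  if (n <= nrank p)%N then x p else 0.


Lemma pairing_tail0 n x z : (forall p, p \in z -> (nrank p.2 < n)%N) ->
  pairing z (tail_fun n x) = 0.
Proof.
move=> zn; rewrite /pairing big_seq big1// => p /zn pn.
by rewrite /tail_fun leqNgt pn mulr0.
Qed.

Lemma pairing_tail_id n x z : (forall p, p \in z -> (n <= nrank p.2)%N) ->
  pairing z (tail_fun n x) = pairing z x.
Proof.
move=> zn; rewrite /pairing big_seq [RHS]big_seq; apply: eq_bigr => p /zn pn.
by rewrite /tail_fun pn.
Qed.

(** The norming set is stable under restriction to nodes of rank at least [n]. Ranks grow along a
    branch, so a segment restricts to a shorter segment. In a join either [n] falls in the range of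
    [f], and only [f] is restricted, or [f] disappears and the restriction of [g] is joined to the
    empty functional. *)
Lemma treeK_tail m l n z : treeK m l z -> (n <= l)%N ->
  exists2 z', treeK n l z' &
    forall x, pairing z' x = pairing z (tail_fun n x).
Proof.
move=> Kz; elim: Kz n => {m l z}.
- by move=> m l _ n nl; exists [::] => [|x]; [exact: treeK_nil|rewrite !pairing_nil].
- move=> m l z _ IH n /IH[z' Kz' zz']; exists (scale_seq (-1) z').
    exact: treeK_neg.
  by move=> x; rewrite !pairing_scale zz'.
- move=> m l s a b ml ab bs ma bl n nl.
  have [k kE] : exists k, k = (b - a)%N by exists (b - a)%N.
  elim: k a kE ab ma => [|k IH] a kE ab ma.
    by move: ab; rewrite -subn_gt0 -kE.
  have [na|an] := leqP n (rank (take a.+1 s)).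
    exists (segment s a b) => [|x]; first exact: treeK_segment.
    rewrite pairing_tail_id// => p /mapP[j]; rewrite mem_iota => /andP[aj jb] ->.
    rewrite subnKC ?(ltnW ab)// in jb.
    by rewrite nrank_word_node ?(leq_trans jb bs)// (leq_trans na)// leq_rank_take.
  have segE x : pairing (segment s a b) (tail_fun n x) =
      pairing (segment s a.+1 b) (tail_fun n x).
    rewrite segment_cons// pairing_cons /tail_fun nrank_word_node ?(leq_trans ab)//.
    by rewrite leqNgt an /= mulr0 add0r.
  have [ab1|ab1] := ltnP a.+1 b.
    have [] := IH a.+1 _ ab1.
    + by rewrite subnS -kE.
    + by rewrite (leq_trans ma)// leq_rank_take.
    by move=> z' Kz' zz'; exists z' => // x; rewrite zz' segE.
  exists [::] => [|x]; first exact: treeK_nil.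
  by rewrite segE segment_nil// !pairing_nil.
- move=> m k l f g v Kf IHf Kg IHg v01 n nl.
  have [nk|kn] := leqP n k.
    have [f' Kf' ff'] := IHf _ nk.
    exists (scale_seq (1 - v ^+ r.+2) f' ++ scale_seq (v ^+ r.+1) g).
      exact: treeK_join Kf' Kg v01.
    move=> x; rewrite !pairing_cat !pairing_scale ff' (pairing_tail_id _ (z := g))//.
    by move=> p /(treeK_support Kg)/andP[/(leq_trans nk)].
  have [g' Kg' gg'] := IHg _ nl.
  exists (scale_seq (1 - v ^+ r.+2) [::] ++ scale_seq (v ^+ r.+1) g').
    exact: treeK_join (treeK_nil (leqnn n)) Kg' v01.
  move=> x; rewrite !pairing_cat !pairing_scale gg' (pairing_tail0 _ (z := f)) ?pairing_nil//.
  by move=> p /(treeK_support Kf)/andP[_ /ltn_trans]; exact.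
Qed.

Definition delta_fun {S : eqType} (p p' : S) : R := (p' == p)%:R.

(** All coefficients are at most 1 in absolute value: the two parts of a join have disjoint ranges
    of ranks, so a node meets only one of them, and both factors lie between 0 and 1. *)
Lemma treeK_delta m n z p : treeK m n z ->
  `|pairing z (delta_fun p)| <= (m <= nrank p < n)%N%:R.
Proof.
elim=> {m n z}.
- by move=> m n _; rewrite pairing_nil normr0 ler0n.
- by move=> m n z _; rewrite pairing_scale mulN1r normrN.
- move=> m n s a b mn ab bs ma bn.
  have [/andP[mp pn]|mpn] := boolP (m <= nrank p < n)%N; last first.
    rewrite [pairing _ _]big_seq big1 ?normr0// => p' p's.
    rewrite /delta_fun; case: eqP => [p'p|]; last by rewrite mulr0.
    move: mpn; rewrite -p'p.
    by rewrite (treeK_support (treeK_segment mn ab bs ma bn) p's).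
  rewrite /pairing big_map; under eq_bigr do rewrite mul1r.
  rewrite ger0_norm; last by apply: sumr_ge0 => l _; rewrite /delta_fun ler0n.
  rewrite -natr_sum ler_nat /delta_fun.
  (* A node determines its depth, so a segment contains it at most once. *)
  apply: (@leq_trans (\sum_(l <- iota a (b - a)) (l == size p.1))%N); last first.
    rewrite (_ : \sum_(l <- _) _ = count_mem (size p.1) (iota a (b - a)))%N.
      by rewrite count_uniq_mem ?iota_uniq// leq_b1.
    by rewrite -sum1_count [RHS]big_mkcond.
  rewrite big_seq [leqRHS]big_seq; apply: leq_sum => l.
  rewrite mem_iota subnKC ?(ltnW ab)// => /andP[al lb].
  case: eqP => //= <-; rewrite size_take (leq_trans lb bs).
  by rewrite eqxx.
- move=> m n l f g v Kf IHf Kg IHg /andP[v0 v1].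
  rewrite pairing_cat !pairing_scale.
  have v2 : 0 <= 1 - v ^+ r.+2 <= 1.
    by rewrite subr_ge0 exprn_ile1//= lerBlDr lerDl exprn_ge0.
  have v3 : 0 <= v ^+ r.+1 <= 1 by rewrite exprn_ge0//= exprn_ile1.
  rewrite (le_trans (ler_normD _ _))// !normrM.
  have /andP[v20 v21] := v2; have /andP[v30 v31] := v3.
  rewrite (ger0_norm v20) (ger0_norm v30).
  apply: (le_trans (lerD (ler_wpM2l v20 IHf) (ler_wpM2l v30 IHg))).
  have mn := treeK_leq Kf; have nl := treeK_leq Kg.
  have [np|pn] := leqP n (nrank p).
    rewrite (leq_trans mn np) /= mulr0 add0r.
    by rewrite ler_piMl// ler0n.
  rewrite (leq_trans pn nl) /= mulr0 addr0 !andbT.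
  by rewrite ler_piMl// ler0n.
Qed.

End tree.

Section unrestricted.
Context {R : realType} {S : Type}.
Variable K : set (seq (R * S)).
Hypothesis K_nil : K [::].
Hypothesis K_coord : forall s, exists2 c : R, 0 < c & K [:: (c, s)].

Lemma setT_submod : submod_closed [pred f : S -> R | `[< [set: S -> R] f >]].
Proof. by split=> [|a f g _ _]; apply/asboolP. Qed.

Definition full_norming : norming S :=
  Norming (nP := setT) K_nil K_coord setT_submod (fun _ _ => I).

End unrestricted.

Section coordinates.
Context {R : realType}.

Lemma dual_coord S (D : @norming R S) s : exists F : dual (nspace D), forall x, F x = nfun x s.
Proof.
have [C _ FC] := nfun_bound D s.
by apply: (bounded_functional (f := fun x : nspace D => x s) (M := C)).
Qed.

Lemma closed_kernel (V : normedModType R) (F : dual V) : closed [set x | F x = 0].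
Proof.
have -> : [set x | F x = 0] = F @^-1` [set (0 : R)] by [].
apply: closed_comp; last exact: closed_eq.
by move=> x _; exact: functional_continuous.
Qed.

Lemma lin_span_sum (V : normedModType R) T (l : seq T) (c : T -> R) (e : T -> V) :
  lin_span (map e l) (\sum_(p <- l) c p *: e p).
Proof.
case: l => [|p0 l0]; first by rewrite big_nil; exists (fun=> 0); rewrite big_ord0.
move: (p0 :: l0) => {l0} l.
exists (fun i => c (nth p0 l i)); rewrite (big_nth p0) big_mkord size_map.
by apply: eq_bigr => i _; rewrite (nth_map p0).
Qed.

Lemma nfun_sum (S : Type) (D : @norming R S) I (l : seq I) (P : pred I) (F : I -> nspace D) s :
  (\sum_(i <- l | P i) F i) s = \sum_(i <- l | P i) F i s.
Proof. by elim/big_rec2: _ => // i u v _ <-. Qed.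

End coordinates.

(** * The spaces normed by functionals on the tree are separable and a.u.c *)

Section tree_space.
Context {R : realType}.
Variable r : nat.

Definition tree_K : set (seq (R * node)) := [set z | exists n, treeK r 0 n z].

Lemma tree_K_nil : tree_K [::].
Proof. by exists 0; exact: treeK_nil. Qed.

Lemma tree_K_coord p : exists2 c : R, 0 < c & tree_K [:: (c, p)].
Proof.
exists 1 => //; exists (nrank p).+1.
have -> : [:: (1, p)] = segment (rcons p.1 p.2) (size p.1) (size p.1).+1 :> seq (R * node).
  rewrite segment_cons// segment_nil// /word_node -cats1 take_size_cat//.
  by rewrite nth_cat ltnn subnn -surjective_pairing.
apply: treeK_segment => //; first by rewrite size_rcons.
by rewrite take_oversize ?size_rcons.
Qed.

Definition tree_norming : norming node := full_norming tree_K_nil tree_K_coord.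

Definition tree_space : completeNormedModType R := nspace tree_norming.

Implicit Types x y : tree_space.

(** Stability of the norming set under a change of sign removes the absolute value. *)
Lemma tree_norm_gt x (e : R) : 0 < e ->
  exists n f, [/\ treeK r 0 n f, `|x| - e < pairing f x & forall m, (n <= m)%N -> treeK r 0 m f].
Proof.
move=> e0; have : `|x| - e < `|x| by rewrite ltrBlDr ltrDl.
move=> /nnorm_gtP[f [n Kf] xf].
suff [g Kg xg] : exists2 g, treeK r 0 n g & `|x| - e < pairing g x.
  by exists n, g; split=> // m nm; exact: (treeK_widen Kg (leqnn 0) nm).
have [fx|fx] := lerP 0 (pairing f x).
  by exists f => //; rewrite -(ger0_norm fx).
exists (scale_seq (-1) f); first exact: treeK_neg.
by rewrite pairing_scale mulN1r -(ltr0_norm fx).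
Qed.

Lemma le_treeK m n z x : treeK r m n z -> `|pairing z x| <= `|x|.
Proof.
by move=> Kz; apply: le_nnorm; exists n; exact: (treeK_widen Kz (leq0n _) (leqnn _)).
Qed.

Lemma treeK_abs m n z (x : node -> R) : treeK r m n z ->
  exists2 z', treeK r m n z' & pairing z' x = `|pairing z x|.
Proof.
move=> Kz; have [zx|zx] := lerP 0 (pairing z x); first by exists z; rewrite ?ger0_norm.
exists (scale_seq (-1) z); first exact: treeK_neg.
by rewrite pairing_scale mulN1r ltr0_norm.
Qed.

(* A functional that nearly attains [`|x|] on nodes of rank below [n] leaves no
   room for those on nodes of rank at least [n]. *)
Lemma treeK_tail_small x n l f g (v M : R) : treeK r 0 n f -> treeK r n l g ->
  `|x| <= M -> 0 < v <= 1 -> `|x| - M * v ^+ r.+2 <= pairing f x ->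
  `|pairing g x| <= 2 * M * v.
Proof.
move=> Kf Kg xM /andP[v0 v1] xf; have [g' Kg' <-] := treeK_abs x Kg.
(* The join with parameter [v] is at most [M] on [x]. With the lower bound on [pairing f x], this
   leaves at most [2 M v^(r+2)] for [v^(r+1)] times the value of [g']. *)
have := le_treeK x (treeK_join Kf Kg' (introT andP (conj (ltW v0) v1))).
rewrite pairing_cat !pairing_scale => /(le_trans (ler_norm _)).
have fx : pairing f x <= M.
  by rewrite (le_trans (ler_norm _))// (le_trans (le_treeK x Kf)).
have q0 : 0 < v ^+ r.+1 by rewrite exprn_gt0.
move=> H; rewrite -(ler_pM2l q0).
have -> : v ^+ r.+1 * (2 * M * v) = M * v ^+ r.+2 + M * v ^+ r.+2.
  by rewrite [v ^+ r.+2]exprSr; ring.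
have : v ^+ r.+2 * pairing f x <= v ^+ r.+2 * M.
  by rewrite ler_wpM2l// exprn_ge0// ltW.
move: H xf; rewrite mulrBl mul1r; lra.
Qed.

Lemma delta_bounded p : (delta_fun p : node -> R) \in npred tree_norming.
Proof.
apply/asboolP; split=> //; exists 1 => z [n Kz].
by rewrite (le_trans (treeK_delta _ Kz))// lern1 leq_b1.
Qed.

Definition tree_delta p : tree_space := NSpace (delta_bounded p).

Fixpoint short_words (k n : nat) : seq word := if k is k'.+1 then
  [::] :: [seq c :: s | c <- [seq (i, j) | i <- iota 0 n, j <- iota 0 n], s <- short_words k' n]
  else [:: [::]].

Lemma mem_short_words k n s : (rank s < n)%N -> (size s <= k)%N -> s \in short_words k n.
Proof.
elim: k s => [|k IH] [|[i j] s]//=; rewrite ?inE ?eqxx//.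
rewrite /rank big_cons -/(rank s) => sn sk.
apply/allpairsP; exists ((i, j), s); split=> //=.
  apply/allpairsP; exists (i, j); split=> //; rewrite mem_iota /= add0n.
    by move: sn => /=; lia.
  by move: sn => /=; lia.
by apply: IH => //; rewrite (leq_ltn_trans _ sn)// leq_addl.
Qed.

(** A finite list containing all nodes of rank below [n]; it may contain others, which [truncation]
    filters out. *)
Definition low_nodes (n : nat) : seq node :=
  undup [seq (p.1, (p.2, j)) | p <- [seq (s, i) | s <- short_words n n, i <- iota 0 n], j <- iota 0 n].

Lemma size_leq_rank s : (size s <= rank s)%N.
Proof.
by rewrite /rank -sum1_size; apply: leq_sum.
Qed.

Lemma mem_low_nodes n p : (nrank p < n)%N -> p \in low_nodes n.
Proof.
case: p => s [i j]; rewrite /nrank rank_rcons mem_undup /= => sn.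
have := size_leq_rank s => ss.
apply/allpairsP; exists ((s, i), j) => /=; split=> //; last first.
  by rewrite mem_iota; lia.
apply/allpairsP; exists (s, i) => /=; split=> //.
  by apply: mem_short_words; lia.
by rewrite mem_iota; lia.
Qed.

Definition truncation (n : nat) x : tree_space :=
  \sum_(p <- low_nodes n | (nrank p < n)%N) (x p : R) *: tree_delta p.

Lemma truncationE n x p : truncation n x p = if (nrank p < n)%N then x p else 0.
Proof.
rewrite /truncation nfun_sum.
rewrite (eq_bigr (fun p' => nfun x p' * delta_fun p' p))//.
case: ifPn => pn.
  rewrite big_mkcond /= (bigD1_seq p) ?undup_uniq ?mem_low_nodes//= pn /delta_fun eqxx mulr1.
  by rewrite big1 ?addr0// => p' /negPf p'p; case: ifP => // _; rewrite eq_sym p'p mulr0.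
rewrite big1// => p' p'n; rewrite /delta_fun; case: eqP => [pp'|]; last by rewrite mulr0.
by rewrite pp' p'n in pn.
Qed.

(** Take [n] beyond the support of a functional that almost norms [x]. Any functional restricted to
    ranks from [n] on can be joined to it, so [treeK_tail_small] bounds the remainder. *)
Lemma truncation_close x (e : R) : 0 < e -> exists n, `|x - truncation n x| <= e.
Proof.
move=> e0; pose M := `|x| + 1; have M0 : 0 < M by rewrite ltr_wpDl.
(* This ensures both [v <= 1] and [2 M v <= e]. *)
pose v := e / (2 * M + e).
have v0 : 0 < v by rewrite divr_gt0// addr_gt0// mulr_gt0.
have v1 : v <= 1 by rewrite ler_pdivrMr ?mul1r ?lerDr ?addr_gt0 ?mulr_gt0// ltW// mulr_gt0.
have ve : 2 * M * v <= e.
  rewrite mulrA ler_pdivrMr ?addr_gt0 ?mulr_gt0// mulrC; apply: ler_wpM2l; first exact: ltW.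
  by rewrite lerDl ltW.
have [n [f [Kf xf _]]] := tree_norm_gt x (mulr_gt0 M0 (exprn_gt0 r.+2 v0)).
exists n; apply: nnorm_le => z [l Kz]; rewrite (le_trans _ ve)//.
have [|g Kg gz] := treeK_tail (treeK_widen Kz (leqnn 0) (leq_maxl l n)) (n := n).
  exact: leq_maxr.
have -> : pairing z (x - truncation n x) = pairing g x.
  rewrite gz; apply: eq_pairing => p.
  rewrite -[LHS]/(x p - truncation n x p) truncationE /tail_fun.
  by case: ltnP => _ /=; rewrite ?subrr ?subr0.
apply: treeK_tail_small Kf Kg _ _ (ltW xf); last by rewrite v0.
by rewrite lerDl.
Qed.

Lemma tree_dense x (d : R) : 0 < d -> exists w : seq (R * node),
  `|x - \sum_(p <- w) p.1 *: tree_delta p.2| <= d.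
Proof.
move=> d0; have [n xn] := truncation_close x d0.
exists [seq (nfun x p, p) | p <- low_nodes n & (nrank p < n)%N].
by rewrite big_map big_filter.
Qed.

Lemma tree_separable : separable tree_space.
Proof. exact: separable_span tree_dense. Qed.

Lemma tree_infinite_dimensional : infinite_dimensional tree_space.
Proof.
apply: (@biorthogonal_infinite_dimensional _ _ (fun n => tree_delta ([::], (n, 0%N)))
  (fun n x => x ([::], (n, 0%N)))) => //.
by move=> i j; rewrite /= /delta_fun !xpair_eqE eqxx andbT.
Qed.

Lemma tree_banach : banach tree_space.
Proof. by split; [exact: tree_separable|exact: tree_infinite_dimensional]. Qed.

Lemma tree_low_cof n : @cof R tree_space [set y | forall p, (nrank p < n)%N -> nfun y p = 0].
Proof.
split.
- move=> y cy p pn; have [F FE] := dual_coord tree_norming p.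
  rewrite -FE; apply: (@closed_kernel _ _ F); apply: closure_subset cy => u /= u0.
  by rewrite FE u0.
- split=> [//|a u v u0 v0 p pn].
  by rewrite -[LHS]/(a * nfun u p + nfun v p) u0// v0// mulr0 addr0.
- exists [seq tree_delta p | p <- low_nodes n] => x; exists (x - truncation n x).
    move=> p pn; rewrite -[LHS]/(nfun x p - truncation n x p) truncationE pn.
    by rewrite subrr.
  rewrite opprB addrCA subrr addr0 /truncation big_mkcond.
  rewrite (eq_bigr (fun p => (if (nrank p < n)%N then nfun x p else 0) *: tree_delta p)).
    exact: lin_span_sum.
  by move=> p _; case: ifP => _; rewrite ?scale0r.
Qed.

(** Let [f] almost norm [x] below rank [n], let [Y] consist of the vectors vanishing below rank [n],
    and let [h] almost norm [y] in [Y]. The tail [g] of [h] has the same value on [y] and is small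
    on [x] by [treeK_tail_small]. The join of [f] and [g] with parameter of order [t] loses
    [w^(r+2)] on [x] and gains about three times as much on [y]. *)
Lemma tree_auc_modulus (t : R) : 0 < t <= 1 ->
  ((1 + (t / 4) ^+ r.+2 / 2)%:E <= ereal_inf [set ereal_sup
    [set ereal_inf [set (`|x + y|%R)%:E | y in [set y | Y y /\ t <= `|y|]%R] | Y in @cof R tree_space]
    | x in [set x : tree_space | (`|x|%R) = 1%R]])%E.
Proof.
move=> /andP[t0 t1]; apply/le_ereal_inf_tmp => _ [x /= x1 <-].
pose w := t / 4; have w0 : 0 < w by rewrite divr_gt0.
have w1 : w <= 1 / 4 by rewrite ler_pM2r// invr_gt0.
(* The precision [v^(r+2)] is at most a quarter of the gain [w^(r+2)], and [2 v = w] is what [g] may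
   lose on [x]. *)
pose v := w / 2; have v0 : 0 < v by rewrite divr_gt0.
have vv : v ^+ r.+2 <= w ^+ r.+2 / 4.
  rewrite /v expr_div_n ler_pM2l ?exprn_gt0// lef_pV2 ?posrE ?exprn_gt0//.
  by rewrite 2!exprS mulrA -natrM ler_peMr// exprn_ege1// ler1n.
have [n [f [Kf xf Kf']]] := tree_norm_gt x (exprn_gt0 r.+2 v0).
apply: le_ereal_sup_tmp; eexists.
  by exists [set y | forall p, (nrank p < n)%N -> nfun y p = 0]; [exact: tree_low_cof|reflexivity].
apply/le_ereal_inf_tmp => _ [y /= [yn ty] <-]; rewrite lee_fin.
have [l [h [Kh yh Kh']]] := tree_norm_gt y (exprn_gt0 r.+2 v0).
have [|g Kg gh] := treeK_tail (Kh' _ (leq_maxl l n)) (n := n); first exact: leq_maxr.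
have gy : pairing g y = pairing h y.
  rewrite gh; apply: eq_pairing => p; rewrite /tail_fun.
  by case: leqP => // pn; rewrite yn.
have gx : `|pairing g x| <= 2 * v.
  have := treeK_tail_small (v := v) (M := 1) Kf Kg; rewrite mulr1; apply.
  - by rewrite x1.
  - by rewrite v0 /v; lra.
  - by rewrite mul1r ltW.
have fxy : pairing f (x + y) = pairing f x.
  rewrite pairingD [pairing f y]big_seq big1 ?addr0// => p /(treeK_support Kf)/andP[_ pn].
  by rewrite yn// mulr0.
have w01 : 0 <= w <= 1 by rewrite ltW//; lra.
have := le_treeK (x + y) (treeK_join Kf Kg w01).
rewrite pairing_cat !pairing_scale => /(le_trans (ler_norm _)).
apply: le_trans; rewrite fxy.
have -> : pairing g (x + y) = pairing g x + pairing h y by rewrite pairingD gy.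
have P0 : 0 <= w ^+ r.+1 by rewrite exprn_ge0// ltW.
have P1 : w ^+ r.+1 <= 1 by rewrite exprn_ile1 ?ltW//; lra.
have Q0 : 0 <= v ^+ r.+2 by rewrite exprn_ge0// ltW.
have Wv : w ^+ r.+1 * v ^+ r.+2 <= v ^+ r.+2 by rewrite ler_piMl.
have W1 : w ^+ r.+2 * (1 - v ^+ r.+2) <= w ^+ r.+2.
  by apply: ler_piMr; [rewrite exprn_ge0// ltW|rewrite gerBl].
have F1 : (1 - w ^+ r.+2) * (1 - v ^+ r.+2) <= (1 - w ^+ r.+2) * pairing f x.
  apply: ler_wpM2l; last by rewrite -x1 ltW.
  by rewrite subr_ge0; apply: exprn_ile1; [exact: ltW|lra].
have F2 : w ^+ r.+1 * (3 * w - v ^+ r.+2) <= w ^+ r.+1 * (pairing g x + pairing h y).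
  apply: ler_wpM2l => //; move: gx; rewrite ler_norml => /andP[gx _].
  by move: yh ty gx; rewrite /v /w; lra.
have E1 : w ^+ r.+1 * (3 * w - v ^+ r.+2) = 3 * w ^+ r.+2 - w ^+ r.+1 * v ^+ r.+2.
  by rewrite [w ^+ r.+2]exprSr; ring.
have E2 : (1 - w ^+ r.+2) * (1 - v ^+ r.+2) = 1 - v ^+ r.+2 - w ^+ r.+2 * (1 - v ^+ r.+2).
  by ring.
rewrite -/w; lra.
Qed.

(** Fewer vectors are far when [t] grows, so [t] may be replaced by its minimum with 1. *)
Lemma tree_auc : auc tree_space.
Proof.
move=> t t0; rewrite /auc_modulus sube_gt0.
pose t' := Num.min t 1; have t'0 : 0 < t' by rewrite lt_min t0 ltr01.
have t'1 : t' <= 1 by rewrite ge_min lexx orbT.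
apply: (@lt_le_trans _ _ (1 + (t' / 4) ^+ r.+2 / 2)%:E).
  by rewrite lte_fin ltrDl divr_gt0// exprn_gt0// divr_gt0.
apply: (le_trans (tree_auc_modulus (introT andP (conj t'0 t'1)))).
apply: le_ereal_inf_tmp => _ [x x1 <-].
apply: (@le_trans _ _ (ereal_sup
    [set ereal_inf [set (`|x + y|%R)%:E | y in [set y | Y y /\ t' <= `|y|]] | Y in @cof R tree_space])).
  by apply: ereal_inf_lbound; exists x.
apply: ge_ereal_sup => _ [Y YY <-].
apply: le_ereal_sup_tmp; eexists; first by exists Y => //; reflexivity.
apply: le_ereal_inf_tmp => _ [y [Yy ty] <-]; apply: ereal_inf_lbound.
by exists y => //; split=> //; rewrite (le_trans _ ty)// ge_min lexx.
Qed.

End tree_space.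

(** * Sums in the sense of l2 *)

Section l2_sum.
Context {R : realType} {S : countType}.
Variable D : nat -> @norming R S.
Hypothesis D_full : forall i, nP (D i) = setT.

Definition lift_seq (i : nat) (w : seq (R * S)) : seq (R * (nat * S)) :=
  [seq (p.1, (i, p.2)) | p <- w].

Lemma pairing_lift i w (x : nat * S -> R) :
  pairing (lift_seq i w) x = pairing w (fun s => x (i, s)).
Proof. by rewrite /pairing big_map. Qed.

Definition l2_combine (alpha : nat -> R) (w : nat -> seq (R * S)) (m : nat) :=
  flatten [seq scale_seq (alpha i) (lift_seq i (w i)) | i <- iota 0 m].

Lemma pairing_l2_combine alpha w m (x : nat * S -> R) :
  pairing (l2_combine alpha w m) x =
  \sum_(i < m) alpha i * pairing (w i) (fun s => x (nat_of_ord i, s)).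
Proof.
rewrite -(big_mkord xpredT (fun i => alpha i * pairing (w i) (fun s => x (i, s)))).
rewrite /index_iota subn0 /l2_combine.
elim: (iota 0 m) => [|i l IH]; first by rewrite big_nil pairing_nil.
by rewrite big_cons -IH /= pairing_cat pairing_scale pairing_lift.
Qed.

(** By duality the l2-sum is normed by the combinations of norming functionals of the summands with
    coefficients in the unit ball of l2. The condition on [z] involves its pairings only, so it does
    not depend on the order of the list. *)
Definition l2_K : set (seq (R * (nat * S))) := [set z |
  exists (alpha : nat -> R) (w : nat -> seq (R * S)) (m : nat),
  [/\ \sum_(i < m) alpha i ^+ 2 <= 1, forall i, nK (D i) (w i) &
      forall x : nat * S -> R, pairing z x =
        \sum_(i < m) alpha i * pairing (w i) (fun s => x (nat_of_ord i, s))]].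

Lemma l2_K_nil : l2_K [::].
Proof.
exists (fun=> 0), (fun=> [::]), 0%N; split; first by rewrite big_ord0.
  by move=> i; exact: nK_nil.
by move=> x; rewrite pairing_nil big_ord0.
Qed.

Lemma l2_K_lift i w : nK (D i) w -> l2_K (lift_seq i w).
Proof.
move=> Kw; exists (fun j => (j == i)%:R), (fun j => if j == i then w else [::]), i.+1.
split=> [|j|x].
- rewrite big_ord_recr /= big1 ?add0r ?eqxx ?expr1n// => j _.
  by rewrite ltn_eqF// expr0n.
- by case: eqP => [->|_] //; exact: nK_nil.
- rewrite pairing_lift big_ord_recr /= big1 ?add0r => [|j _].
    by rewrite eqxx mul1r.
  by rewrite ltn_eqF// mul0r.
Qed.

Lemma l2_K_coord p : exists2 c : R, 0 < c & l2_K [:: (c, p)].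
Proof.
case: p => i s; have [c c0 Kc] := nK_coord (D i) s; exists c => //.
exact: (l2_K_lift Kc).
Qed.

Definition l2_norming : norming (nat * S) := full_norming l2_K_nil l2_K_coord.

Definition l2_space : completeNormedModType R := nspace l2_norming.

Lemma l2_component_bounded i (x : l2_space) :
  (fun s => nfun x (i, s)) \in npred (D i).
Proof.
apply/asboolP; rewrite D_full; split=> //; exists `|x| => w Kw.
by have := le_nnorm x (l2_K_lift Kw : nK l2_norming _); rewrite pairing_lift; exact.
Qed.

Definition l2_component i (x : l2_space) : nspace (D i) :=
  NSpace (l2_component_bounded i x).

Lemma l2_component_linear i : linear (l2_component i).
Proof. by move=> a x y; apply/val_inj/funext. Qed.

HB.instance Definition _ i := GRing.isLinear.Build R l2_space (nspace (D i)) *:%R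
  (l2_component i) (@l2_component_linear i).

(** Almost norming functionals of the components, with coefficients proportional to the norms of the
    components and with the right signs, form a member of [l2_K] that almost attains the l2-norm. *)
Lemma l2_component_sum_le (x : l2_space) m :
  \sum_(i < m) `|l2_component i x| ^+ 2 <= `|x| ^+ 2.
Proof.
set A := \sum_(i < m) _; have A0 : 0 <= A by apply: sumr_ge0 => i _; rewrite exprn_ge0.
rewrite -(sqr_sqrtr A0) ler_sqr ?nnegrE ?sqrtr_ge0//.
set s := Num.sqrt A; have [->//|s0] := eqVneq s 0.
have {}s0 : 0 < s by rewrite lt_def s0 sqrtr_ge0.
have sA : s ^+ 2 = A by rewrite sqr_sqrtr.
pose a i := `|l2_component i x|; have a0 i : 0 <= a i := normr_ge0 _.
apply/ler_addgt0Pr => e e0; pose C := \sum_(i < m) a i / s.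
have C0 : 0 <= C by apply: sumr_ge0 => i _; rewrite divr_ge0 /a // ltW.
pose d := e / (C + 1); have d0 : 0 < d by rewrite divr_gt0// ltr_wpDl.
have /choice[w wP] i : exists w, nK (D i) w /\ a i - d < `|pairing w (l2_component i x)|.
  have : a i - d < a i by rewrite ltrBlDr ltrDl.
  by move=> /nnorm_gtP[w Kw aw]; exists w.
pose b i := Num.sg (pairing (w i) (l2_component i x)) * (a i / s).
have Kz : l2_K (l2_combine b w m).
  exists b, w, m; split; last exact: pairing_l2_combine.
    2: by move=> i; have [] := wP i.
  apply: (@le_trans _ _ (\sum_(i < m) a i ^+ 2 / s ^+ 2)).
    apply: ler_sum => i _; rewrite /b exprMn -[leRHS]mul1r expr_div_n.
    apply: ler_wpM2r; first by rewrite divr_ge0 ?sqr_ge0.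
    by rewrite sqr_sg lern1 leq_b1.
  by rewrite -mulr_suml -[X in X / _]/A -sA divff// expf_eq0 gt_eqF.
have := le_nnorm x Kz; rewrite pairing_l2_combine => /(le_trans (ler_norm _)) xz.
have : \sum_(i < m) (a i / s) * (a i - d) <= `|x|.
  apply: le_trans xz; apply: ler_sum => i _.
  rewrite -[X in _ <= b i * X]/(pairing (w i) (l2_component i x)) /b.
  rewrite [leRHS]mulrAC -normrEsg [leRHS]mulrC ler_wpM2l// ?divr_ge0 ?a0 ?(ltW s0)//.
  by have [_ /ltW] := wP i.
have -> : \sum_(i < m) (a i / s) * (a i - d) = s - d * C.
  under eq_bigr do rewrite mulrBr mulrAC -expr2 [_ * d]mulrC.
  rewrite sumrB -mulr_suml -mulr_sumr; congr (_ - _).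
  by rewrite -[X in X / _]/A -sA expr2 mulfK// gt_eqF.
rewrite lerBlDr => /le_trans; apply; rewrite lerD2l /d mulrAC ler_pdivrMr ?ltr_wpDl//.
by rewrite ler_wpM2l ?ltW// ltrDl.
Qed.

(** This is the Cauchy-Schwarz inequality. Here [x] is any function, so that vectors can be glued
    from their components. *)
Lemma l2_pairing_le (x : nat * S -> R) (a : nat -> R) (M : R) z : 0 <= M ->
  (forall i w, nK (D i) w -> `|pairing w (fun s => x (i, s))| <= a i) ->
  (forall m, \sum_(i < m) a i ^+ 2 <= M ^+ 2) -> l2_K z -> `|pairing z x| <= M.
Proof.
move=> M0 xa aM [b [w [m [b1 Kw ->]]]].
have a0 i : 0 <= a i by apply: le_trans (xa i [::] (nK_nil _)).
rewrite (le_trans (ler_norm_sum _ _ _))//.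
apply: (@le_trans _ _ (\sum_(i < m) `|b i| * a i)).
  by apply: ler_sum => i _; rewrite normrM ler_wpM2l// xa.
have [M00|M00] := eqVneq M 0.
  rewrite big1 ?M00// => i _; have : a i ^+ 2 <= 0.
    have := aM i.+1; rewrite M00 expr0n big_ord_recr /=; apply: le_trans.
    by rewrite lerDr sumr_ge0// => j _; rewrite exprn_ge0.
  by rewrite real_exprn_even_le0 ?num_real//= => /eqP ->; rewrite mulr0.
have {}M0 : 0 < M by rewrite lt_def M00.
(* Each product is split by the inequality of arithmetic and geometric means, weighted so that both
   sums contribute at most [M / 2]. *)
apply: (@le_trans _ _ (\sum_(i < m) (b i ^+ 2 * (M / 2) + a i ^+ 2 / (2 * M)))).
  apply: ler_sum => i _; rewrite -(ler_pM2r (_ : 0 < 2 * M)) ?mulr_gt0//.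
  have -> : (b i ^+ 2 * (M / 2) + a i ^+ 2 / (2 * M)) * (2 * M) =
     (`|b i| * M) ^+ 2 + a i ^+ 2.
    by rewrite exprMn real_normK ?num_real//; field; rewrite gt_eqF.
  have := sqr_ge0 (`|b i| * M - a i); rewrite sqrrB -mulr_natl; lra.
rewrite big_split /= -!mulr_suml (le_trans (lerD (ler_wpM2r _ b1) (ler_wpM2r _ (aM m))))//.
- by rewrite divr_ge0// ltW.
- by rewrite invr_ge0 mulr_ge0// ltW.
by rewrite le_eqVlt; apply/orP; left; apply/eqP; field; rewrite gt_eqF.
Qed.

Lemma l2_gluingP (x : nat * S -> R) (a : nat -> R) (M : R) : 0 <= M ->
  (forall i w, nK (D i) w -> `|pairing w (fun s => x (i, s))| <= a i) ->
  (forall m, \sum_(i < m) a i ^+ 2 <= M ^+ 2) ->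
  exists2 X : l2_space, nfun X = x & `|X| <= M.
Proof.
move=> M0 xa aM; have xP : x \in npred l2_norming.
  by apply/asboolP; split=> //; exists M => z; exact: (l2_pairing_le M0 xa aM).
by exists (NSpace xP) => //; apply: nnorm_le => z; exact: (l2_pairing_le M0 xa aM).
Qed.

Lemma series_sqr_nondecreasing (u : nat -> R) :
  nondecreasing_seq (series (fun n => u n ^+ 2)).
Proof.
by apply/nondecreasing_seqP => n; rewrite seriesSr lerDl sqr_ge0.
Qed.

Lemma series_sqr_cvg (u : nat -> R) (M : R) : (forall m, \sum_(i < m) u i ^+ 2 <= M) ->
  cvgn (series (fun n => u n ^+ 2)) /\ limn (series (fun n => u n ^+ 2)) <= M.
Proof.
move=> uM; have cu : cvgn (series (fun n => u n ^+ 2)).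
  apply: nondecreasing_is_cvgn; first exact: series_sqr_nondecreasing.
  by exists M => _ [n _ <-]; rewrite /series /= big_mkord.
split=> //; apply: limr_le => //; near=> n.
by rewrite /series /= big_mkord.
Unshelve. all: by end_near. Qed.

(** One inequality between the norms is [l2_component_sum_le]; the other one and surjectivity come
    from [l2_gluingP], for the coordinates of [x] and for a given sequence [y]. *)
Lemma l2_is_l2_sum : is_l2_sum l2_space (fun i => nspace (D i)).
Proof.
exists (fun i => l2_component i : {linear l2_space -> nspace (D i)}); split.
  move=> x; have [cx lx] := @series_sqr_cvg (fun i => `|l2_component i x|) _ (l2_component_sum_le x); split=> //.
  apply/eqP; rewrite eq_le; apply/andP; split.
    by rewrite -[leRHS]ger0_norm// -sqrtr_sqr ler_wsqrtr.
  have [] := @l2_gluingP x (fun i => `|l2_component i x|)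
    (l2_sum_norm (fun n => l2_component n x)).
  - exact: sqrtr_ge0.
  - by move=> i w Kw; exact: (le_nnorm (l2_component i x) Kw).
  - move=> m; rewrite sqr_sqrtr.
      have := nondecreasing_cvgn_le (@series_sqr_nondecreasing (fun i => `|l2_component i x|)) cx m.
      by rewrite /series /= big_mkord.
    apply: limr_ge => //; near=> n.
    by rewrite /series /= sumr_ge0// => i _; rewrite exprn_ge0.
  by move=> X XE; have -> : X = x by apply/val_inj.
move=> y cy; have [] := @l2_gluingP (fun p => y p.1 p.2) (fun i => `|y i|)
    (l2_sum_norm y).
- exact: sqrtr_ge0.
- by move=> i w Kw; exact: (le_nnorm (y i) Kw).
- move=> m; rewrite sqr_sqrtr.
    have := nondecreasing_cvgn_le (@series_sqr_nondecreasing (fun i => `|y i|)) cy m.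
    by rewrite /series /= big_mkord.
  apply: limr_ge => //; near=> n.
  by rewrite /series /= sumr_ge0// => i _; rewrite exprn_ge0.
by move=> X XE _; exists X => n; apply/val_inj/funext => s /=; rewrite XE.
Unshelve. all: by end_near. Qed.

End l2_sum.

(** * Separability of the l2-sum and of its predual *)

Section l2_sum_banach.
Context {R : realType} {S : countType}.
Variable D : nat -> @norming R S.
Hypothesis D_full : forall i, nP (D i) = setT.
Variable s0 : S.
Hypothesis D_delta : forall i s, (delta_fun s : S -> R) \in npred (D i).
Hypothesis D_dense : forall i (f : nspace (D i)) (d : R), 0 < d ->
  exists w : seq (R * S), `|f - \sum_(p <- w) p.1 *: NSpace (D_delta i p.2)| <= d.

Let X := l2_space D.
Let comp i : X -> nspace (D i) := l2_component D_full i.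

Lemma l2_embedP i (f : nspace (D i)) : exists2 x : X,
  nfun x = (fun p => if p.1 == i then f p.2 else 0) & `|x| <= `|f|.
Proof.
apply: (l2_gluingP (a := fun j => if j == i then `|f| else 0)) => [//|j w Kw|m].
  have [ji|ji] := eqVneq j i.
    by rewrite ji in Kw *; have := le_nnorm f Kw.
  by rewrite -[X in pairing w X]/(0 : S -> R) pairing0 normr0.
apply: (@le_trans _ _ (\sum_(j < m) if (j : nat) == i then `|f| ^+ 2 else 0)).
  by apply: ler_sum => j _; case: ifP => _ //; rewrite expr0n.
rewrite -big_mkcond /=; case: (ltnP i m) => im.
  by rewrite (big_pred1 (Ordinal im)).
by rewrite big_pred0 ?sqr_ge0// => j; rewrite ltn_eqF// (leq_trans (ltn_ord j)).
Qed.

Definition l2_embed i (f : nspace (D i)) : X := s2val (cid2 (l2_embedP f)).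

Lemma l2_embedE i (f : nspace (D i)) p :
  nfun (l2_embed f) p = if p.1 == i then nfun f p.2 else 0.
Proof. by rewrite /l2_embed; case: cid2 => x /= ->. Qed.

Lemma norm_l2_embed i (f : nspace (D i)) : `|l2_embed f| = `|f|.
Proof.
apply/eqP; rewrite eq_le; apply/andP; split.
  by rewrite /l2_embed; case: cid2.
apply: nnorm_le => w Kw.
have := le_nnorm (l2_embed f) (l2_K_lift Kw : nK (l2_norming D) _).
rewrite pairing_lift; congr (_ <= _); congr `|_|; apply: eq_pairing => s.
by rewrite l2_embedE eqxx.
Qed.

Lemma l2_embed_linear i : linear (@l2_embed i).
Proof.
move=> a f g; apply/val_inj/funext => p.
rewrite -[RHS]/(a * nfun (l2_embed f) p + nfun (l2_embed g) p).
rewrite -[LHS]/(nfun (l2_embed (a *: f + g)) p) !l2_embedE.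
by case: ifP; rewrite ?mulr0 ?addr0.
Qed.

HB.instance Definition _ i := GRing.isLinear.Build R (nspace (D i)) X *:%R
  (@l2_embed i) (@l2_embed_linear i).

Definition l2_delta (p : nat * S) : X := l2_embed (NSpace (D_delta p.1 p.2)).

Lemma l2_deltaE p p' : nfun (l2_delta p) p' = (p' == p)%:R.
Proof.
rewrite /l2_delta l2_embedE /=; case: p p' => [i s] [j s'] /=.
by rewrite xpair_eqE; case: eqP.
Qed.

Lemma l2_truncation_close (x : X) (d : R) : 0 < d ->
  exists m, `|x - \sum_(i < m) l2_embed (comp i x)| <= d.
Proof.
move=> d0; pose a i := `|comp i x|.
have [cx lx] := @series_sqr_cvg _ a _ (l2_component_sum_le D_full x).
set L := limn _ in lx.
have /cvgrPdist_le/(_ (d ^+ 2) (exprn_gt0 2 d0))[m _ mL] := cx.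
have aL k : \sum_(i < k) a i ^+ 2 <= L.
  have := nondecreasing_cvgn_le (@series_sqr_nondecreasing _ a) cx k.
  by rewrite /series /= big_mkord.
exists m; set y := x - _.
have yE i s : nfun y (i, s) = if (i < m)%N then 0 else nfun x (i, s).
  rewrite -[LHS]/(nfun x (i, s) - nfun (\sum_(i < m) l2_embed (comp i x)) (i, s)).
  rewrite nfun_sum; under eq_bigr do rewrite l2_embedE /=.
  case: ltnP => im; last first.
    by rewrite big1 ?subr0// => j _; rewrite gtn_eqF// (leq_trans (ltn_ord j)).
  rewrite (bigD1 (Ordinal im))//= eqxx big1 ?addr0 ?subrr// => j.
  by rewrite -val_eqE /= eq_sym => /negPf ->.
have [] := @l2_gluingP _ _ D (nfun y) (fun i => if (i < m)%N then 0 else a i) d (ltW d0).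
- move=> i w Kw; have [im|im] := ltnP i m.
    have -> : pairing w (fun s => nfun y (i, s)) = pairing w (0 : S -> R).
      by apply: eq_pairing => s; rewrite yE im.
    by rewrite pairing0 normr0.
  apply: le_trans (le_nnorm (comp i x) Kw); rewrite le_eqVlt; apply/orP; left.
  by apply/eqP; congr `|_|; apply: eq_pairing => s; rewrite yE ltnNge im.
- pose b i := if (i < m)%N then 0 else a i.
  (* With [m + k] terms instead of [k] the sum is a difference of two partial sums of a convergent
     series. *)
  move=> k; have bk : \sum_(i < k) b i ^+ 2 <= \sum_(i < m + k) b i ^+ 2.
    have := @series_sqr_nondecreasing _ b k (m + k)%N (leq_addl _ _).
    by rewrite /series /= !big_mkord.
  apply: le_trans bk _.
  have -> : \sum_(i < m + k) b i ^+ 2 = \sum_(i < m + k) a i ^+ 2 - \sum_(i < m) a i ^+ 2.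
    elim: k => [|k IH].
      rewrite addn0 subrr big1// => i _; by rewrite /b ltn_ord expr0n.
    by rewrite addnS !big_ord_recr /= IH /b ltnNge leq_addr /= addrAC.
  have := mL m (leqnn m); rewrite -/L /series /= big_mkord ler_norml => /andP[_].
  have := aL (m + k)%N; lra.
by move=> Y YE; have -> : Y = y by apply/val_inj.
Qed.

Lemma l2_dense (x : X) (d : R) : 0 < d ->
  exists w : seq (R * (nat * S)), `|x - \sum_(p <- w) p.1 *: l2_delta p.2| <= d.
Proof.
move=> d0; have d2 : 0 < d / 2 by rewrite divr_gt0.
have [m xm] := l2_truncation_close x d2.
suff [w xw] : exists w : seq (R * (nat * S)),
    `|\sum_(i < m) l2_embed (comp i x) - \sum_(p <- w) p.1 *: l2_delta p.2| <= d / 2.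
  exists w; rewrite -(subrKA (\sum_(i < m) l2_embed (comp i x))).
  by rewrite (splitr d) (le_trans (ler_normD _ _))// lerD.
elim: m (d / 2) d2 {xm} => [|m IH] e e0.
  by exists [::]; rewrite big_ord0 big_nil subrr normr0 ltW.
have e2 : 0 < e / 2 by rewrite divr_gt0.
have [w mw] := IH _ e2; have [w' mw'] := D_dense (comp m x) e2.
exists (w ++ lift_seq m w'); rewrite big_cat big_ord_recr /= opprD addrACA.
rewrite (splitr e) (le_trans (ler_normD _ _))// lerD// /lift_seq big_map /=.
rewrite (_ : \sum_(p <- w') _ = l2_embed (\sum_(p <- w') p.1 *: NSpace (D_delta m p.2))).
  by rewrite -linearB norm_l2_embed.
by rewrite linear_sum; apply: eq_bigr => p _; rewrite linearZ.
Qed.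

Lemma l2_banach : banach X.
Proof.
split; first exact: separable_span l2_dense.
apply: (@biorthogonal_infinite_dimensional _ _ (fun n => l2_delta (n, s0))
  (fun n x => nfun x (n, s0))) => // i j.
by rewrite l2_deltaE xpair_eqE eqxx andbT.
Qed.

Lemma l2_dual_banach : dual_banach X.
Proof.
exists (nspace (predual (l2_norming D))); split; last exact: predual_isometry.
split.
  apply: (separable_span (e := fun p => predual_pairing (l2_norming D) [:: (1, p)])).
  move=> phi d /(predual_approx phi)[w phiw]; exists w.
  rewrite (_ : \sum_(p <- w) _ = predual_pairing (l2_norming D) w)//.
  apply/val_inj/funext => x /=.
  by rewrite nfun_sum; apply: eq_bigr => p _ /=; rewrite fctE /= pairing1 mul1r.
apply: (@biorthogonal_infinite_dimensional _ _
  (fun n => predual_pairing (l2_norming D) [:: (1, (n, s0))])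
  (fun n phi => nfun phi (l2_delta (n, s0)))) => // i j.
by rewrite /= pairing1 mul1r l2_deltaE xpair_eqE eqxx andbT eq_sym.
Qed.

End l2_sum_banach.

(** * The Hahn-Banach theorem *)

Section hahn_banach.
Context {R : realType} {V : lmodType R}.
Variable p : V -> R.
Hypothesis pD : forall x y, p (x + y) <= p x + p y.
Hypothesis pZ : forall (a : R) x, 0 <= a -> p (a *: x) = a * p x.

(** Partial linear functionals dominated by [p], encoded as graphs so that unions of chains are
    immediate. Domination forces such a graph to be single-valued. *)
Definition linear_graph (G : set (V * R)) :=
  [/\ G (0, 0), forall a u v, G u -> G v -> G (a *: u.1 + v.1, a * u.2 + v.2) &
      forall u, G u -> u.2 <= p u.1].

(** Subadditivity of [p] puts every lower constraint on the value at [x] below every upper one; the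
    supremum [c] of the lower ones is the new value. *)
Lemma linear_graph_extend (G : set (V * R)) (x : V) : linear_graph G ->
  exists G', [/\ linear_graph G', G `<=` G' & exists r, G' (x, r)].
Proof.
move=> [G0 GD Gp].
have GB u v : G u -> G v -> G (u.1 - v.1, u.2 - v.2).
  by move=> Gu Gv; have := GD (-1) _ _ Gv Gu; rewrite scaleN1r mulN1r addrC [- _ + _]addrC.
have GDD u v : G u -> G v -> G (u.1 + v.1, u.2 + v.2).
  by move=> Gu Gv; have := GD 1 _ _ Gu Gv; rewrite scale1r mul1r.
have GZ a u : G u -> G (a *: u.1, a * u.2).
  by move=> Gu; have := GD a _ _ Gu G0; rewrite !addr0.
pose A := [set u.2 - p (u.1 - x) | u in G].
have AU v : G v -> ubound A (p (v.1 + x) - v.2).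
  move=> Gv _ [u Gu <-]; rewrite lerBrDr addrAC lerBlDr.
  apply: (le_trans (Gp _ (GDD _ _ Gu Gv))); rewrite /=.
  by rewrite -[X in p X](_ : (v.1 + x) + (u.1 - x) = _) ?pD// addrC addrACA addNr addr0.
have A0 : A !=set0 by exists ((0 : V * R).2 - p ((0 : V * R).1 - x)), 0.
have supA : has_sup A by split=> //; exists (p ((0 : V * R).1 + x) - (0 : V * R).2); exact: (AU 0).
pose c := sup A.
have c1 u : G u -> u.2 - c <= p (u.1 - x).
  by move=> Gu; rewrite lerBlDr -lerBlDl; apply: ub_le_sup; [case: supA|exists u].
have c2 u : G u -> u.2 + c <= p (u.1 + x).
  by move=> Gu; rewrite -lerBrDl; apply: ge_sup => //; exact: AU.
exists [set w | exists u a, G u /\ w = (u.1 + a *: x, u.2 + a * c)]; split; [split| |].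
- by exists (0, 0), 0; rewrite scale0r mul0r !addr0.
- move=> a _ _ [u [b [Gu ->]]] [v [d [Gv ->]]] /=.
  exists (a *: u.1 + v.1, a * u.2 + v.2), (a * b + d); split; first exact: GD.
  rewrite /= scalerDr scalerDl mulrDr mulrDl scalerA mulrA.
  by rewrite addrACA [a * u.2 + _ + _]addrACA.
- move=> _ [u [a [Gu ->]]] /=.
  have [a0|a0|->] := ltrgtP a 0; last by rewrite scale0r mul0r !addr0 Gp.
    have b0 : 0 < - a by rewrite oppr_gt0.
    have := c1 _ (GZ (- a)^-1 _ Gu); rewrite /= -(ler_pM2l b0) -(pZ _ (ltW b0)).
    rewrite scalerBr scalerA mulfV ?gt_eqF// scale1r scaleNr opprK.
    by rewrite mulrBr mulrA mulfV ?gt_eqF// mul1r mulNr opprK.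
  have := c2 _ (GZ a^-1 _ Gu); rewrite /= -(ler_pM2l a0) -(pZ _ (ltW a0)).
  rewrite scalerDr scalerA mulfV ?gt_eqF// scale1r.
  by rewrite mulrDr mulrA mulfV ?gt_eqF// mul1r.
- by move=> [u1 u2] Gu; exists (u1, u2), 0; rewrite scale0r mul0r !addr0.
- by exists c, (0, 0), 1; rewrite scale1r mul1r !add0r.
Qed.

Theorem hahn_banach (G : set (V * R)) : linear_graph G ->
  exists f : V -> R, [/\ forall a x y, f (a *: x + y) = a * f x + f y,
    forall x, f x <= p x & forall u, G u -> f u.1 = u.2].
Proof.
move=> lG.
(* Zorn is applied to the sets to be added to [G], so that the empty chain, whose union is empty,
   causes no exception. *)
have [F FP totF|A [lM maxA]] := @Zorn_bigcup _ [set H | linear_graph (G `|` H)].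
  have [G0 GD Gp] := lG; split=> /=; first by left.
    move=> a u v [Gu|[X FX Xu]] [Gv|[Y FY Yv]]; first by left; exact: GD.
    - have [_ YD _] := FP _ FY.
      by have [] := YD a u v (or_introl Gu) (or_intror Yv); [left|right; exists Y].
    - have [_ XD _] := FP _ FX.
      by have [] := XD a u v (or_intror Xu) (or_introl Gv); [left|right; exists X].
    - have [XY|YX] := totF _ _ FX FY.
        have [_ YD _] := FP _ FY.
        by have [] := YD a u v (or_intror (XY _ Xu)) (or_intror Yv); [left|right; exists Y].
      have [_ XD _] := FP _ FX.
      by have [] := XD a u v (or_intror Xu) (or_intror (YX _ Yv)); [left|right; exists X].
  move=> u [Gu|[X FX Xu]]; first exact: Gp.
  by have [_ _ Xp] := FP _ FX; apply: Xp; right.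
set M := G `|` A in lM; have [M0 MD Mp] := lM.
have fun_M x r s : M (x, r) -> M (x, s) -> r = s.
  move=> Mr Ms; have Mrs : M (0, r - s).
    by have := MD (-1) _ _ Ms Mr; rewrite /= scaleN1r mulN1r addNr addrC.
  apply/eqP; rewrite -subr_eq0 -normr_le0.
  pose a : R := Num.sg (r - s).
  have p0 : p 0 = 0 by have := pZ 0 (lexx 0); rewrite scale0r mul0r.
  have := Mp _ (MD a _ _ Mrs M0); rewrite /= !addr0 scaler0 p0.
  by rewrite -normrEsg.
have totM x : exists r, M (x, r).
  have [M' [lM' MM' [r M'x]]] := linear_graph_extend x lM.
  exists r; apply: contrapT => Mx; apply: (maxA M').
    split; first by apply: subset_trans MM'; exact: subsetUr.
    by move=> /(_ _ M'x) Ax; apply: Mx; right.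
  by rewrite /= (_ : G `|` M' = M')//; apply/setUidPr; apply: subset_trans MM'; exact: subsetUl.
have [f fM] := choice totM.
have fE x r : M (x, r) -> f x = r.
  by move=> Mx; exact: fun_M (fM x) Mx.
exists f; split.
- by move=> a x y; apply: fE; exact: (MD a _ _ (fM x) (fM y)).
- by move=> x; exact: (Mp _ (fM x)).
- by move=> [x r] Gu; apply: fE; left.
Qed.

End hahn_banach.

(** * Functionals and finite codimensional subspaces under an equivalent norm *)

Section renorming.
Context {R : realType} {V : normedModType R}.
Variable N : V -> R.
Hypothesis eqN : equivalent_norm N.

Lemma equivD x y : N (x + y) <= N x + N y. Proof. by case: eqN. Qed.

Lemma equivZ (a : R) x : N (a *: x) = `|a| * N x. Proof. by case: eqN. Qed.

Lemma equiv0 : N 0 = 0.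
Proof. by rewrite -(scale0r (0 : V)) equivZ normr0 mul0r. Qed.

Lemma equivN x : N (- x) = N x.
Proof. by rewrite -scaleN1r equivZ normrN1 mul1r. Qed.

Lemma equivB x y : N x - N y <= N (x - y).
Proof. by rewrite lerBlDr (le_trans _ (equivD _ _))// subrK. Qed.

Lemma equiv_ge0 x : 0 <= N x.
Proof.
have [_ _ _ [c [C [c0 C0 /(_ x)[cx _]]]]] := eqN.
by apply: le_trans cx; rewrite mulr_ge0// ltW.
Qed.

Lemma equiv_upper : exists2 C : R, 0 < C & forall x, N x <= C * `|x|.
Proof. by have [_ _ _ [c [C [c0 C0 H]]]] := eqN; exists C => // x; case: (H x). Qed.

Lemma equiv_lower : exists2 c : R, 0 < c & forall x, c * `|x| <= N x.
Proof. by have [_ _ _ [c [C [c0 C0 H]]]] := eqN; exists c => // x; case: (H x). Qed.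

(** The dual norm of [N] enters only through its upper bounds. *)
Definition dual_le (f : dual V) (M : R) := forall x, `|f x| <= M * N x.

Lemma dual_addE (f g : dual V) x : (f + g) x = f x + g x. Proof. by []. Qed.

Lemma dual_oppE (f : dual V) x : (- f) x = - f x. Proof. by []. Qed.

Lemma dual_scaleE (a : R) (f : dual V) x : (a *: f) x = a * f x. Proof. by []. Qed.

Lemma dual_leP (f : dual V) (M : R) : (forall x, N x <= 1 -> f x <= M) -> dual_le f M.
Proof.
move=> fM x; have M0 : 0 <= M by have := fM 0; rewrite equiv0 linear0; apply.
have [Nx|Nx] := eqVneq (N x) 0.
  have [_ _ N0 _] := eqN.
  by rewrite (N0 x Nx) linear0 normr0 mulr_ge0// equiv_ge0.
have {}Nx : 0 < N x by rewrite lt_def Nx equiv_ge0.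
rewrite ler_norml; apply/andP; split; last first.
  rewrite -ler_pdivrMr//; have := fM ((N x)^-1 *: x).
  rewrite equivZ gtr0_norm ?invr_gt0// mulVf ?gt_eqF//.
  by rewrite linearZ /= -[_ *: _]/(_ * _) mulrC; apply.
rewrite lerNl -ler_pdivrMr//; have := fM (- ((N x)^-1 *: x)).
rewrite equivN equivZ gtr0_norm ?invr_gt0// mulVf ?gt_eqF//.
by rewrite linearN linearZ /= -[_ *: _]/(_ * _) mulNr mulrC; apply.
Qed.

Lemma dual_of_linear (f : V -> R) (M : R) :
  (forall (a : R) x y, f (a *: x + y) = a * f x + f y) ->
  (forall x, f x <= M * `|x|) -> exists F : dual V, forall x, F x = f x.
Proof.
move=> fl fM; apply: (@bounded_functional _ _ (f : V -> R^o) M fl) => x.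
have f0 : f 0 = 0.
  have := fl 1 0 0; rewrite scaler0 addr0 mul1r => /esym/eqP.
  by rewrite -subr_eq0 addrK => /eqP.
have fN : f (- x) = - f x.
  by have := fl (-1) x 0; rewrite scaleN1r !addr0 f0 addr0 mulN1r.
suff : `|f x| <= M * `|x| by [].
by rewrite ler_norml fM andbT lerNl -fN -(normrN x) fM.
Qed.

Lemma norming_functional x : exists F : dual V, F x = N x /\ dual_le F 1.
Proof.
have [||f [fl fN fG]] := @hahn_banach R V N equivD _ [set u | exists a : R, u = (a *: x, a * N x)].
- by move=> a y a0; rewrite equivZ ger0_norm.
- split=> /=.
  + by exists 0; rewrite scale0r mul0r.
  + move=> a _ _ [b ->] [d ->] /=; exists (a * b + d).
    by rewrite scalerDl scalerA mulrDl mulrA.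
  + by move=> _ [a ->] /=; rewrite equivZ ler_wpM2r ?equiv_ge0// ler_norm.
have [C C0 NC] := equiv_upper.
have [F FE] : exists F : dual V, forall x, F x = f x.
  by apply: (dual_of_linear (M := C)) => // y; rewrite (le_trans (fN y)).
exists F; split.
  by rewrite FE; apply: (fG (x, N x)); exists 1; rewrite scale1r mul1r.
by apply: dual_leP => y Ny; rewrite FE (le_trans (fN y)).
Qed.

(** Since [Y] is closed, [v] has a positive distance [d] from it, and the functional [a *: v + y] to
    [a] is dominated by the norm divided by [d]; it extends by Hahn-Banach. *)
Lemma separating_functional (Y : set V) v : closed Y -> Defs.subspace Y -> ~ Y v ->
  exists F : dual V, (forall y, Y y -> F y = 0) /\ F v = 1.
Proof.
move=> Yc [Y0 YD] Yv.
have YZ (a : R) y : Y y -> Y (a *: y).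
  by move=> Yy; have := YD a y 0 Yy Y0; rewrite addr0.
have [d d0 dY] : exists2 d : R, 0 < d & forall y, Y y -> d <= `|v - y|.
  have : open (~` Y) by exact: closed_openC.
  rewrite openE => /(_ v Yv) /nbhs_ballP[d /= d0 dY]; exists d => // y Yy.
  by rewrite leNgt; apply/negP => vy; apply: (dY y) => //; rewrite -ball_normE.
have dYa (a : R) y : Y y -> a <= `|a *: v + y| / d.
  move=> Yy; rewrite ler_pdivlMr//.
  have [a0|a0] := lerP a 0.
    by rewrite (le_trans _ (normr_ge0 _))// mulr_le0_ge0// ltW.
  have -> : a *: v + y = a *: (v - (- a^-1 *: y)).
    by rewrite scalerBr scalerA mulrN mulfV ?gt_eqF// scaleN1r opprK.
  by rewrite normrZ gtr0_norm// ler_pM2l// dY//; exact: YZ.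
have [|||f [fl fN fG]] := @hahn_banach R V (fun x => `|x| / d) _ _
    [set u | exists a y, Y y /\ u = (a *: v + y, a)].
- by move=> x y; rewrite -mulrDl ler_wpM2r ?invr_ge0 ?(ltW d0)// ler_normD.
- by move=> a y a0; rewrite normrZ ger0_norm// mulrA.
- split=> /=.
  + by exists 0, 0; rewrite scale0r addr0.
  + move=> a _ _ [b [y [Yy ->]]] [e [z [Yz ->]]] /=; exists (a * b + e), (a *: y + z).
    split; first exact: YD.
    by rewrite scalerDr scalerA scalerDl addrACA.
  + by move=> _ [a [y [Yy ->]]] /=; exact: dYa.
have [F FE] : exists F : dual V, forall x, F x = f x.
  by apply: (dual_of_linear (M := d^-1)) => // y; rewrite mulrC.
exists F; split=> [y Yy|]; rewrite FE.
  by apply: (fG (y, 0)); exists 0, y; rewrite scale0r add0r.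
by apply: (fG (v, 1)); exists 1, 0; rewrite scale1r addr0.
Qed.

(** A subspace in [cof] contains, up to [e], a whole weak neighbourhood of 0. By induction on the
    spanning vectors of a complement: if [v] is outside [Y], a functional [F] with kernel containing
    [Y] and [F v = 1] projects the span of [Y] and [v] onto [Y], and smallness of [F u] makes the
    correction small. *)
Lemma cof_approx (Y : set V) (e : R) : @cof R V Y -> 0 < e ->
  exists (Fs : seq (dual V)) (t : R), 0 < t /\
    forall u, (forall F, F \in Fs -> `|F u| <= t) -> exists2 y, Y y & `|u - y| <= e.
Proof.
move=> [Yc Ys [s sY]]; elim: s Y Yc Ys sY e => [|v s IH] Y Yc Ys sY e e0.
  exists [::], 1; split=> // u _; have [y Yy [a]] := sY u.
  rewrite big_ord0 => /eqP; rewrite subr_eq0 => /eqP ->.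
  by exists y => //; rewrite subrr normr0 ltW.
have [Yv|Yv] := pselect (Y v).
  apply: (IH Y) => // u; have [y Yy [a uy]] := sY u.
  have [Y0 YD] := Ys.
  exists (a ord0 *: v + y); first exact: YD.
  exists (fun i => a (lift ord0 i)); rewrite opprD addrCA uy big_ord_recl addKr.
  by [].
have [F [FY Fv]] := separating_functional Yc Ys Yv.
(* This is the span of [Y] and [v], written as a preimage of [Y] so that it is visibly closed. *)
pose Y' := [set u | Y (u - F u *: v)].
have YY' y : Y y -> Y' y by move=> Yy; rewrite /Y' /= FY// scale0r subr0.
have Y's : Defs.subspace Y'.
  have [Y0 YD] := Ys; split; first exact: YY'.
  move=> a x y Yx Yy.
  have E : a *: x + y - F (a *: x + y) *: v = a *: (x - F x *: v) + (y - F y *: v).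
    rewrite linearP -[X in X *: v]/(a * F x + F y) scalerDl opprD addrACA.
    by rewrite scalerBr scalerA.
  by rewrite /Y' /= E; exact: YD.
have Y'c : closed Y'.
  apply: (@closed_comp _ _ (fun u => u - F u *: v)) => // x _.
  apply: cvgB; first exact: cvg_id.
  by apply: cvgZr_tmp; exact: functional_continuous.
have [Fs [t [t0 HFs]]] : exists (Fs : seq (dual V)) (t : R), 0 < t /\
    forall u, (forall F, F \in Fs -> `|F u| <= t) ->
    exists2 y, Y' y & `|u - y| <= e / 2 / (1 + dual_norm F * `|v|).
  apply: IH => //.
    move=> u; have [y Yy [a uy]] := sY u.
    exists (a ord0 *: v + y).
      have [Y0 YD] := Y's; apply: YD; last exact: YY'.
      by rewrite /Y' /= Fv scale1r subrr; case: Ys.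
    by exists (fun i => a (lift ord0 i)); rewrite opprD addrCA uy big_ord_recl addKr.
  by rewrite !divr_gt0// ltr_pwDl// mulr_ge0// dual_norm_ge0.
pose t' := e / 2 / (1 + `|v|); have v0 : 0 < 1 + `|v| by rewrite ltr_pwDl.
have t'0 : 0 < t' by rewrite !divr_gt0.
exists (F :: Fs), (Num.min t t'); split; first by rewrite lt_min t0 t'0.
move=> u uF; have [G GFs|y Y'y uy] := HFs u.
  by have := uF G; rewrite inE GFs orbT le_min => /(_ isT)/andP[].
exists (y - F y *: v) => //.
have -> : u - (y - F y *: v) = (u - y) - F (u - y) *: v + F u *: v.
  have -> : F (u - y) = (F u : R) - F y by rewrite linearB.
  by rewrite scalerBl !opprB -[RHS]addrA subrK addrA addrAC.
have Fu : `|F u| <= t'.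
  by have := uF F; rewrite inE eqxx le_min => /(_ isT)/andP[].
have k0 : 0 < 1 + dual_norm F * `|v| by rewrite ltr_pwDl// mulr_ge0// dual_norm_ge0.
rewrite (splitr e) (le_trans (ler_normD _ _))// lerD//.
  rewrite (le_trans (ler_normB _ _))// normrZ.
  apply: (@le_trans _ _ (`|u - y| * (1 + dual_norm F * `|v|))).
    rewrite mulrDr mulr1 lerD2l mulrA [`|u - y| * _]mulrC ler_wpM2r//.
    exact: le_dual_norm.
  by rewrite -ler_pdivlMr.
rewrite normrZ; apply: (@le_trans _ _ (t' * (1 + `|v|))).
  by rewrite ler_pM// lerDr.
by rewrite /t' mulfVK ?gt_eqF.
Qed.

End renorming.

(** * Weak compactness and asymptotic smoothness of the dual norm *)

Section weak_compactness.
Context {R : realType} {V : normedModType R}.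
Variable N : V -> R.
Hypothesis eqN : equivalent_norm N.
Hypothesis reflV : reflexive_space V.

(** The bidual sits in this product, whose topology induces the weak topology on [V]. *)
Definition dual_functions := prod_topology (fun _ : dual V => R^o).

HB.instance Definition _ := Topological.copy dual_functions
  (prod_topology (fun _ : dual V => R^o)).
HB.instance Definition _ := isPointed.Build dual_functions (fun=> 0).

Local Notation T := dual_functions.

Definition evaluation (x : V) : T := fun f => f x.

Lemma apply_continuous (f : dual V) : continuous (fun phi : T => phi f).
Proof. exact: proj_continuous. Qed.

(** Tychonoff gives a compact cube. Linearity, the bound by 1 on the dual ball of [N] and the value
    at [g] are closed conditions; by reflexivity the functions satisfying them are evaluations, at
    points of the [N]-ball by a norming functional. *)
Lemma slice_compact (g : dual V) (rho : R) :
  compact (evaluation @` [set x | N x <= 1 /\ rho <= g x]).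
Proof.
have [c c0 cN] := equiv_lower eqN.
pose K := [set phi : T | forall f, `[- (dual_norm f / c), dual_norm f / c]%classic (phi f)].
have Kc : compact K.
  apply: (@tychonoff (dual V) (fun=> R^o)
    (fun f => `[- (dual_norm f / c), dual_norm f / c]%classic)) => f.
  exact: segment_compact.
pose L := [set phi : T | forall t : R * dual V * dual V,
   phi (t.1.1 *: t.1.2 + t.2) - (t.1.1 * phi t.1.2 + phi t.2) = 0].
have Lc : closed L.
  move=> phi cphi [[a f] h]; pose F (psi : T) : R := psi (a *: f + h) - (a * psi f + psi h).
  have Fc : closed [set psi | F psi = 0].
    have Fcont : continuous (F : T -> R^o).
      move=> psi; have c1 := @apply_continuous (a *: f + h) psi.
      have c2 := @apply_continuous f psi; have c3 := @apply_continuous h psi.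
      exact: (cvgB c1 (cvgD (@cvgZl_tmp _ _ _ _ _ a _ _ c2) c3)).
    exact: (@closed_comp _ _ F _ (fun psi _ => Fcont psi) (@closed_eq R 0)).
  by apply: Fc; apply: closure_subset cphi => psi /(_ (a, f, h)).
pose M := [set phi : T | forall f : dual V, dual_le N f 1 -> phi f <= 1].
have Mc : closed M.
  move=> phi cphi f f1.
  have Fc : closed [set psi : T | psi f <= 1].
    apply: (@closed_comp _ _ (fun psi : T => psi f) [set x | x <= 1]) (@closed_le R 1).
    by move=> psi _; exact: apply_continuous.
  by apply: Fc; apply: closure_subset cphi => psi /(_ f f1).
pose P := [set phi : T | rho <= phi g].
have Pc : closed P.
  apply: (@closed_comp _ _ (fun psi : T => psi g) [set x | rho <= x]) (@closed_ge R rho).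
  by move=> psi _; exact: apply_continuous.
rewrite (_ : _ @` _ = K `&` (L `&` (M `&` P))); last first.
  apply/seteqP; split.
    move=> _ [x [Nx gx] <-]; split; last split; last split.
    - move=> f /=; rewrite in_itv /= -ler_norml ler_pdivlMr//.
      rewrite (le_trans (ler_wpM2r (ltW c0) (le_dual_norm f x)))//.
      rewrite -mulrA ler_piMr ?dual_norm_ge0// mulrC (le_trans (cN x))//.
    - by move=> t; rewrite /evaluation /= subrr.
    - move=> f f1; rewrite /evaluation (le_trans (ler_norm _))// (le_trans (f1 x))//.
      by rewrite mul1r.
    - by [].
  move=> phi [Kphi [Lphi [Mphi Pphi]]].
  have phil (a : R) f h : phi (a *: f + h) = a * phi f + phi h.
    by apply/eqP; rewrite -subr_eq0; apply/eqP; exact: (Lphi (a, f, h)).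
  have [Phi PhiE] : exists Phi : dual (dual V), forall f, Phi f = phi f.
    apply: (@bounded_functional _ _ (phi : dual V -> R^o) c^-1 phil) => f.
    by have := Kphi f; rewrite /= in_itv /= -ler_norml mulrC.
  have [x xE] := reflV Phi.
  have phiE f : phi f = f x by rewrite -PhiE xE.
  exists x; last by apply/funext => f; rewrite /evaluation phiE.
  split; last by rewrite -phiE.
  have [F [Fx F1]] := norming_functional eqN x.
  by rewrite -Fx -phiE; exact: Mphi.
by apply: compact_closedI => //; apply: closedI => //; exact: closedI.
Qed.

Lemma weak_nbhs_open (l : seq (dual V)) (x : V) (t : R) :
  open [set phi : T | forall F, F \in l -> `|phi F - F x| < t].
Proof.
elim: l => [|F l IH].
  by rewrite (_ : [set _ | _] = setT) ?predeqE//; exact: openT.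
rewrite (_ : [set _ | _] = [set phi : T | `|phi F - F x| < t] `&`
  [set phi : T | forall F, F \in l -> `|phi F - F x| < t]); last first.
  apply/seteqP; split=> phi /=.
    by move=> H; split=> [|G Gl]; apply: H; rewrite inE ?eqxx// Gl orbT.
  by move=> [HF Hl] G; rewrite inE => /orP[/eqP ->//|]; exact: Hl.
apply: openI => //.
apply: (@open_comp _ _ (fun phi : T => `|phi F - F x|) _ _ (@open_lt R t)) => phi _.
have c1 := @apply_continuous F phi.
exact: (cvg_norm (cvgB c1 (cvg_cst (F x : R^o)))).
Qed.

Lemma auc_extract (t : R) : auc_norm N -> 0 < t -> exists2 d : R, 0 < d <= 1 &
  forall x, N x = 1 -> exists2 Y, @cof R V Y & forall y, Y y -> t <= N y -> 1 + d <= N (x + y).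
Proof.
move=> aN t0; have := aN t t0; rewrite /auc_modulus sube_gt0.
set m := ereal_inf _ => m1.
have [d d01 dm] : exists2 d : R, 0 < d <= 1 & ((1 + d)%:E < m)%E.
  (* The infimum may be infinite, in which case any gap is available. *)
  move: m m1 => [r| |] //=.
    rewrite lte_fin => r1; exists (Num.min 1 ((r - 1) / 2)).
      by rewrite lt_min ltr01 divr_gt0 ?subr_gt0//= ge_min lexx.
    rewrite lte_fin; apply: (@le_lt_trans _ _ (1 + (r - 1) / 2)); last lra.
    by rewrite lerD2l ge_min lexx orbT.
  by move=> _; exists 1; rewrite ?ltr01 ?lexx// ltry.
exists d => // x Nx.
have : ((1 + d)%:E < ereal_sup [set ereal_inf [set (N (x + y))%:E | y in [set y | Y y /\ (t <= N y)%R]] | Y in @cof R V])%E.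
  by apply: (lt_le_trans dm); apply: ereal_inf_lbound; exists x.
move=> /ereal_sup_gt[_ [Y YY <-] dY]; exists Y => // y Yy ty.
rewrite -lee_fin (le_trans (ltW dY))//; apply: ereal_inf_lbound.
by exists y.
Qed.

(* Asymptotic uniform smoothness of the dual norm of [N], at a single scale and
   in a form that only refers to finitely many evaluations. *)
Lemma auc_dual_smooth : auc_norm N -> exists2 r : nat, (2 <= r)%N &
  forall (g : dual V) (rho : R), r%:R <= rho -> dual_le N g rho ->
  exists2 Z : seq V, (forall z, z \in Z -> N z <= 1) &
    forall h : dual V, dual_le N h 2 -> (forall z, z \in Z -> `|h z| <= 16^-1) ->
    dual_le N (g + h) (rho + 2^-1).
Proof.
move=> aN; have t0 : (0 : R) < 16^-1 by rewrite invr_gt0.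
have [d /andP[d0 d1] dY] := auc_extract aN t0.
have [r0 rd] : exists r : nat, 16 / d <= r%:R.
  by exists (Num.bound (16 / d)); rewrite ltW// archi_boundP// divr_ge0// ltW.
have [C C0 NC] := equiv_upper eqN.
pose r := (r0 + 2)%N; exists r; first by rewrite leq_addl.
move=> g rho rrho grho.
have rho2 : 2 <= rho by rewrite (le_trans _ rrho)// ler_nat leq_addl.
have rhod : 16 / d <= rho by rewrite (le_trans rd)// (le_trans _ rrho)// ler_nat leq_addr.
(* Only this slice matters: elsewhere in the ball [g b < rho - 2], while [h b <= 2]. *)
pose A := [set x | N x <= 1 /\ rho - 2 <= g x].
have local x : exists p : seq (dual V) * R, 0 < p.2 /\
    forall (h : dual V) b, A x -> dual_le N h 2 -> N b <= 1 -> `|h x| <= 16^-1 ->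
      (forall F, F \in p.1 -> `|F (b - x)| <= p.2) -> h b <= 2^-1.
  have [Ax|Ax] := pselect (A x); last by exists ([::], 1); split.
  have [x1 gx] := Ax; set k := N x in x1.
  (* As [rho] is at least [16 / d], points of the slice have [N]-norm at least [1 - d / 8]. *)
  have k8 : 8 - d <= 8 * k.
    have rk : rho * (1 - k) <= 2.
      rewrite mulrBr mulr1; have := grho x; rewrite -/k.
      by move=> /(le_trans (ler_norm _)); lra.
    have : 16 <= rho * d by rewrite -ler_pdivrMr.
    rewrite leNgt => rd16; apply/negP => kd.
    have rho0 : 0 < rho by lra.
    have : rho * d < rho * (8 * (1 - k)) by rewrite ltr_pM2l//; lra.
    rewrite mulrCA; lra.
  have k0 : 0 < k by lra.
  have Nx1 : N (k^-1 *: x) = 1.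
    by rewrite (equivZ eqN) gtr0_norm ?invr_gt0// mulVf// gt_eqF.
  have [Y YY Yd] := dY _ Nx1.
  have dC : 0 < d / 16 / C by rewrite !divr_gt0.
  have [Fs [t [Ft FsP]]] := cof_approx YY dC.
  exists (Fs, t); split=> // h b _ h2 b1 hx bF.
  have [y Yy bxy] := FsP _ bF; pose e := b - x - y.
  have Ne : N e <= d / 16 by rewrite (le_trans (NC e))// mulrC -ler_pdivlMr.
  have bE : b = x + y + e by rewrite /e -addrA subrKC subrKC.
  (* If [y] is small, [b] is close to [x] in norm and [h b] is small like [h x]. Otherwise
     asymptotic convexity makes [N (x + y)], and then [N b], exceed 1, which is impossible. *)
  have [yk|yk] := ltrP (N y) (k / 16).
    have hy := le_trans (ler_norm _) (h2 y); have he := le_trans (ler_norm _) (h2 e).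
    have hx' := le_trans (ler_norm _) hx.
    have hb : h b = (h x : R) + h y + h e by rewrite [in LHS]bE !linearD.
    rewrite hb; apply: (@le_trans _ _ (16^-1 + 2 * (k / 16) + 2 * (d / 16))); last lra.
    by rewrite !lerD// ?(le_trans hy) ?(le_trans he)// ler_pM2l// ltW.
  have Yk : Y (k^-1 *: y).
    by have [_ [Y0 YD] _] := YY; have := YD k^-1 y 0 Yy Y0; rewrite addr0.
  have := Yd _ Yk; rewrite -scalerDr !(equivZ eqN) gtr0_norm ?invr_gt0//.
  rewrite ler_pdivlMl// => /(_ yk); rewrite ler_pdivlMl// => xy.
  have := equivB eqN (x + y) (- e); rewrite opprK -bE (equivN eqN) => bxye.
  have kd : (1 - d / 8) * (1 + d) <= k * (1 + d) by rewrite ler_pM2r; lra.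
  have dd : d * d <= d by rewrite ler_piMl// ltW.
  have : (1 - d / 8) * (1 + d) = 1 + 7 / 8 * d - d * d / 8 by field.
  lra.
have {local}[p p0] := choice local.
pose U x := [set phi : T | forall F, F \in (p x).1 -> `|phi F - F x| < (p x).2].
have Uo x : open (U x) by exact: weak_nbhs_open.
have AU : evaluation @` A `<=` cover A U.
  move=> _ [x Ax <-]; exists x => // F _.
  by rewrite /evaluation subrr normr0; case: (p0 x).
(* The test set [Z] consists of the centres of finitely many of these weak neighbourhoods covering
   the slice. *)
have := @slice_compact g (rho - 2); rewrite compact_cover => /(_ V A U (fun x _ => Uo x) AU).
move=> [Z ZA ZU]; exists (finmap.enum_fset Z) => [z|h h2 hZ].
  by move=> /ZA; rewrite inE => -[].
apply: (dual_leP eqN) => b b1; rewrite dual_addE.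
have gb : g b <= rho.
  by rewrite (le_trans (ler_norm _))// (le_trans (grho b))// ler_piMr// (le_trans _ rho2).
have hb : h b <= 2.
  by rewrite (le_trans (ler_norm _))// (le_trans (h2 b))// ler_piMr.
have [Ab|Ab] := pselect (A b); last first.
  have : g b < rho - 2 by rewrite ltNge; apply/negP => gb2; apply: Ab.
  lra.
have [x xZ Ux] := ZU _ (imageP evaluation Ab).
have [_ px] := p0 x.
have Ax : A x by move: (ZA x xZ); rewrite inE.
apply: lerD => //; apply: (px h b) => //; first exact: hZ.
move=> F Fp; have := Ux F Fp.
rewrite /evaluation => /ltW; congr (`|_| <= _).
by rewrite linearB.
Qed.

End weak_compactness.

(** * Finite nets for finitely many evaluations *)

Section nets.
Context {R : realType}.

(** The values at one point are cut into finitely many cells of width [e], and the induction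
    hypothesis is applied inside each cell; thus the net stays in [A]. *)
Lemma finite_net (U X : eqType) (ev : U -> X -> R) (l : seq X) (A : set U) (M e : R) :
  0 < e -> (forall u x, A u -> x \in l -> `|ev u x| <= M) ->
  exists2 L : seq U, (forall u, u \in L -> A u) &
    forall u, A u -> exists2 v, v \in L & forall x, x \in l -> `|ev u x - ev v x| <= e.
Proof.
move=> e0; elim: l A => [|x l IH] A AM.
  have [[u0 Au0]|A0] := pselect (exists u, A u).
    exists [:: u0] => [u|u _]; first by rewrite inE => /eqP ->.
    by exists u0; rewrite ?inE.
  by exists [::] => // u Au; exfalso; apply: A0; exists u.
pose cell (k : nat) := [set u | A u /\ k%:R * e <= ev u x + M < k.+1%:R * e].
have /choice[L LP] k : exists L : seq U, (forall u, u \in L -> cell k u) /\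
    forall u, cell k u -> exists2 v, v \in L & forall y, y \in l -> `|ev u y - ev v y| <= e.
  have [|L L1 L2] := IH (cell k); last by exists L.
  by move=> u y [Au _] yl; apply: AM => //; rewrite inE yl orbT.
pose K := Num.bound (2 * M / e).
exists (flatten [seq L k | k <- iota 0 K]) => [u /flattenP[_ /mapP[k _ ->] /(LP k).1[]]//|u Au].
have uM : `|ev u x| <= M by apply: AM => //; rewrite inE eqxx.
have M0 : 0 <= M by rewrite (le_trans _ uM).
pose k := Num.truncn ((ev u x + M) / e).
have u0 : 0 <= (ev u x + M) / e.
  by rewrite divr_ge0 ?(ltW e0)//; move: uM; rewrite ler_norml; lra.
have /andP[k1 k2] := truncn_itv u0.
have cu : cell k u.
  by split=> //; rewrite -ler_pdivlMr// -ltr_pdivrMr// k1.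
have [v vL vl] := (LP k).2 u cu.
exists v => [|y].
  apply/flattenP; exists (L k) => //; apply/mapP; exists k => //.
  rewrite mem_iota add0n /= -(ltr_nat R) (le_lt_trans k1)//.
  apply: (@le_lt_trans _ _ (2 * M / e)); last by rewrite archi_boundP// divr_ge0 ?mulr_ge0// ltW.
  by rewrite ler_pM2r ?invr_gt0//; move: uM; rewrite ler_norml; lra.
rewrite inE => /orP[/eqP ->|]; last exact: vl.
have [_ /andP[]] := (LP k).1 v vL; have [_ /andP[]] := cu.
by rewrite -natr1 mulrDl mul1r ler_norml; lra.
Qed.

End nets.

Section norming_sequence.
Context {R : realType} {V : normedModType R}.
Variable N : V -> R.
Hypothesis eqN : equivalent_norm N.

(** Functionals norming a countable dense set: a dense point within [N x / 4] of [x] costs this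
    amount twice. *)
Lemma norming_sequence : separable V -> exists f : nat -> dual V,
  (forall n, dual_le N (f n) 1) /\ forall x, exists n, N x / 2 <= `|f n x|.
Proof.
move=> [D /countable_injP[g gI] Dd].
have /choice[f fP] n : exists F : dual V, dual_le N F 1 /\
    forall d, D d -> g d = n -> F d = N d.
  have [[d [Dd' gd]]|H] := pselect (exists d, D d /\ g d = n).
    have [F [Fd F1]] := norming_functional eqN d; exists F; split=> // d' Dd'' gd'.
    suff -> : d' = d by [].
    by apply: gI; rewrite ?inE// gd.
  exists 0; split=> [x|d Dd' gd]; last by exfalso; apply: H; exists d.
  by rewrite normr0 mul1r equiv_ge0.
exists f; split=> [n|x]; first by case: (fP n).
have [Nx|Nx] := eqVneq (N x) 0; first by exists 0%N; rewrite Nx mul0r.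
have {}Nx : 0 < N x by rewrite lt_def Nx equiv_ge0.
have [C C0 NC] := equiv_upper eqN.
have e0 : 0 < N x / 4 / C by rewrite !divr_gt0.
have [d [xd Dd']] : ball x (N x / 4 / C) `&` D !=set0.
  by apply: Dd; [exists x; exact: ballxx|exact: ball_open].
exists (g d); have [f1 /(_ d Dd' erefl) fd] := fP (g d).
have Nxd : N (x - d) <= N x / 4.
  rewrite (le_trans (NC _))// mulrC -ler_pdivlMr// ltW//.
  by move: xd; rewrite -ball_normE.
have f2 := f1 (x - d); rewrite mul1r in f2.
have fx : f (g d) x = (f (g d) (x - d) : R) + N d by rewrite -fd -linearD subrK.
have := equivB eqN x (x - d); rewrite opprB addrCA subrr addr0 => Nd.
have : N d - `|f (g d) (x - d)| <= `|(f (g d) (x - d) : R) + N d|.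
  have -> : (f (g d) (x - d) : R) + N d = N d + f (g d) (x - d) by rewrite addrC.
  by apply: le_trans (lerB_normD _ _); rewrite (ger0_norm (equiv_ge0 eqN d)).
rewrite fx; apply: le_trans; move: f2 Nxd Nd; lra.
Qed.

End norming_sequence.

(** * Finite approximation schemes in the dual *)

Section blocks.
Context {R : realType} {V : normedModType R}.
Variable N : V -> R.
Hypothesis eqN : equivalent_norm N.
Implicit Types (f g h : dual V) (Z : seq V) (D : seq (dual V)).

Lemma dual_le_scale f (M a : R) : 0 <= a -> dual_le N f M -> dual_le N (a *: f) (a * M).
Proof. by move=> a0 fM x; rewrite dual_scaleE normrM ger0_norm// -mulrA ler_wpM2l. Qed.

Lemma dual_leD f g (M M' : R) : dual_le N f M -> dual_le N g M' -> dual_le N (f + g) (M + M').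
Proof.
by move=> fM gM x; rewrite dual_addE mulrDl (le_trans (ler_normD _ _))// lerD.
Qed.

Lemma dual_leN f (M : R) : dual_le N f M -> dual_le N (- f) M.
Proof. by move=> fM x; rewrite dual_oppE normrN. Qed.

Lemma dual_le_widen f (M M' : R) : M <= M' -> dual_le N f M -> dual_le N f M'.
Proof. by move=> MM' fM x; rewrite (le_trans (fM x))// ler_wpM2r ?equiv_ge0. Qed.

Lemma dual_le0 (M : R) : 0 <= M -> dual_le N 0 M.
Proof. by move=> M0 x; rewrite normr0 mulr_ge0// equiv_ge0. Qed.

Variable r : nat.
Hypothesis r2 : (2 <= r)%N.

Definition smooth_at (rho : R) Z g := forall h, dual_le N h 2 ->
  (forall z, z \in Z -> `|h z| <= 16^-1) -> dual_le N (g + h) (rho + 2^-1).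

Hypothesis smoothN : forall g (rho : R), r%:R <= rho -> dual_le N g rho ->
  exists2 Z, (forall z, z \in Z -> N z <= 1) & smooth_at rho Z g.

Fixpoint diff_sums D (k : nat) : seq (dual V) :=
  if k is k'.+1 then
    [seq g + uw | g <- diff_sums D k', uw <- [seq u - w | u <- D, w <- D]]
  else [:: 0].

Lemma diff_sumsS D k g u w : g \in diff_sums D k -> u \in D -> w \in D ->
  g + (u - w) \in diff_sums D k.+1.
Proof.
move=> gk uD wD; apply/allpairsP; exists (g, u - w); split=> //=.
by apply/allpairsP; exists (u, w).
Qed.

(* [rho = r + c / 2] runs through the bounds of the partial sums of at most [2r]
   blocks; the factor [r ^ i] is the bound of one block of the [i]-th generation. *)
Definition good Z D (K : nat) := forall k g i c, (k <= K)%N -> g \in diff_sums D k ->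
  (i <= K)%N -> (c <= r.*2)%N -> dual_le N g (r%:R ^+ i * (r%:R + c%:R / 2)) ->
  forall h, dual_le N h (2 * r%:R ^+ i) -> (forall z, z \in Z -> `|h z| <= 16^-1) ->
  dual_le N (g + h) (r%:R ^+ i * (r%:R + c.+1%:R / 2)).

Lemma r_gt0 : 0 < r%:R :> R. Proof. by rewrite ltr0n; lia. Qed.

Definition good_for Z g (i c : nat) :=
  dual_le N g (r%:R ^+ i * (r%:R + c%:R / 2)) ->
  forall h, dual_le N h (2 * r%:R ^+ i) -> (forall z, z \in Z -> `|h z| <= 16^-1) ->
  dual_le N (g + h) (r%:R ^+ i * (r%:R + c.+1%:R / 2)).

(** Smoothness is applied to [g] divided by [r ^ i], and the test values of [h] only shrink under
    this division. Allowing larger test sets lets finitely many instances be merged. *)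
Lemma good_one g i c : exists2 Z : seq V, (forall z, z \in Z -> N z <= 1) &
  forall Z', {subset Z <= Z'} -> good_for Z' g i c.
Proof.
rewrite /good_for; set k := (r%:R : R) ^+ i; have k0 : 0 < k by rewrite exprn_gt0// r_gt0.
have k1 : 1 <= k by rewrite exprn_ege1// ler1n; lia.
have [gk|gk] := pselect (dual_le N g (k * (r%:R + c%:R / 2))); last by exists [::].
have [||Z Z1 gZ] := @smoothN (k^-1 *: g) (r%:R + c%:R / 2).
- by rewrite lerDl divr_ge0.
- rewrite -[X in dual_le _ _ X](mulKf (lt0r_neq0 k0)).
  by apply: dual_le_scale; rewrite ?invr_ge0 ?ltW.
exists Z => // Z' ZZ' _ h h2 hZ.
have -> : g + h = k *: (k^-1 *: g + k^-1 *: h).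
  by rewrite scalerDr !scalerA mulfV ?gt_eqF// !scale1r.
apply: dual_le_scale; first exact: ltW.
have -> : r%:R + c.+1%:R / 2 = r%:R + c%:R / 2 + 2^-1 :> R by rewrite -natr1; lra.
apply: gZ.
  rewrite -[X in dual_le _ _ X](mulKf (lt0r_neq0 k0)) [k * 2]mulrC.
  by apply: dual_le_scale; rewrite ?invr_ge0 ?ltW.
move=> z /ZZ'/hZ hz; rewrite dual_scaleE normrM ger0_norm ?invr_ge0 ?(ltW k0)//.
by rewrite (le_trans _ hz)// ler_piMl// invf_le1.
Qed.

Lemma good_exists Z0 D K : (forall z, z \in Z0 -> N z <= 1) ->
  exists Z, [/\ {subset Z0 <= Z}, forall z, z \in Z -> N z <= 1 & good Z D K].
Proof.
move=> Z01; suff [Z [Z0Z Z1 ZP]] : exists Z, [/\ {subset Z0 <= Z}, forall z, z \in Z -> N z <= 1 &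
    forall q, q \in [seq (g, ic) | g <- flatten [seq diff_sums D k | k <- iota 0 K.+1],
      ic <- [seq (i, c) | i <- iota 0 K.+1, c <- iota 0 r.*2.+1]] -> good_for Z q.1 q.2.1 q.2.2].
  exists Z; split=> // k g i c kK gk iK cr; apply: (ZP (g, (i, c))).
  apply: (allpairs_f (fun g ic => (g, ic))).
    by apply/flattenP; exists (diff_sums D k) => //; apply: map_f; rewrite mem_iota add0n ltnS.
  by apply: (allpairs_f (fun i c => (i, c))); rewrite mem_iota add0n ltnS.
elim: [seq _ | _ <- _, _ <- _] => [|[g [i c]] L [Z [Z0Z Z1 ZP]]]; first by exists Z0; split.
have [Z' Z'1 Z'P] := good_one g i c.
exists (Z ++ Z'); split.
- by move=> z /Z0Z; rewrite mem_cat => ->.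
- by move=> z; rewrite mem_cat => /orP[/Z1|/Z'1].
- move=> q; rewrite inE => /orP[/eqP -> /=|/ZP qZ].
    by apply: Z'P => z zZ'; rewrite mem_cat zZ' orbT.
  move=> gq h h2 hZ; apply: qZ => // z zZ; apply: hZ.
  by rewrite mem_cat zZ.
Qed.

Definition unit_ball : set (dual V) := [set f | dual_le N f 1].

Lemma step_exists (eps : R) (f : nat -> dual V) l Z D : 0 < eps ->
  (forall n, unit_ball (f n)) -> (forall z, z \in Z -> N z <= 1) ->
  exists p : seq V * seq (dual V), [/\ {subset Z <= p.1},
    forall z, z \in p.1 -> N z <= 1, good p.1 D l.+1,
    forall u, u \in p.2 -> unit_ball u &
    f l \in p.2 /\ forall u, unit_ball u ->
      exists2 v, v \in p.2 & forall z, z \in p.1 -> `|u z - v z| <= eps].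
Proof.
move=> e0 f1 Z1; have [Z' [ZZ' Z'1 gZ']] := good_exists D l.+1 Z1.
have [|L L1 L2] := @finite_net R (dual V) V (fun u z => u z) Z' unit_ball 1 eps e0.
  by move=> u z u1 zZ'; rewrite (le_trans (u1 z))// mul1r Z'1.
exists (Z', f l :: L); split=> //= [u|].
  by rewrite inE => /orP[/eqP ->|/L1].
rewrite inE eqxx; split=> // u /L2[v vL uv]; exists v => //.
by rewrite inE vL orbT.
Qed.

(* [tol] bounds the oscillation of all later moves on the test vectors [Zs l]. *)
Definition tol (l : nat) : R := 2^-1 ^+ l / 16.

Lemma tol_gt0 l : 0 < tol l.
Proof. by rewrite divr_gt0// exprn_gt0. Qed.

Lemma tolS l : tol l.+1 = tol l / 2.
Proof. by rewrite /tol exprS; lra. Qed.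

Lemma tol_le l l' : (l <= l')%N -> tol l' <= tol l.
Proof.
move=> ll'; rewrite /tol ler_pM2r ?invr_gt0// ler_wiXn2l//.
by rewrite invf_le1// ler1n.
Qed.

Lemma scheme_exists (f : nat -> dual V) : (forall n, unit_ball (f n)) ->
  exists (Zs : nat -> seq V) (Sig : nat -> seq (dual V)) (Ds : nat -> seq (dual V)),
  [/\ Zs 0 = [::] /\ (forall l z, z \in Zs l -> N z <= 1),
      forall l, {subset Zs l <= Zs l.+1},
      Ds 0 = [:: 0] /\ (forall l, Ds l.+1 = Ds l ++ Sig l),
      forall l, good (Zs l.+1) (Ds l) l.+1 &
      [/\ forall l u, u \in Sig l -> unit_ball u,
          forall l, f l \in Sig l &
          forall l u, unit_ball u -> exists2 v, v \in Sig l &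
            forall z, z \in Zs l.+1 -> `|u z - v z| <= tol l.+1 / 4]].
Proof.
move=> f1.
(* Keeping the bound on test vectors in the type lets a choice function perform every step of the
   recursion. *)
pose W := {Z : seq V | `[< forall z, z \in Z -> N z <= 1 >]}.
have /choice[F FP] (q : nat * (W * seq (dual V))) : exists p : W * seq (dual V),
   [/\ {subset val q.2.1 <= val p.1}, good (val p.1) q.2.2 q.1.+1,
    forall u, u \in p.2 -> unit_ball u &
    f q.1 \in p.2 /\ forall u, unit_ball u ->
      exists2 v, v \in p.2 & forall z, z \in val p.1 -> `|u z - v z| <= tol q.1.+1 / 4].
  case: q => l [[Z /= Z1] D]; have {}Z1' := asboolW Z1.
  have e0 : 0 < tol l.+1 / 4 by rewrite divr_gt0// tol_gt0.
  have [[Z' L] /= [ZZ' Z'1 gZ' L1 L2]] := @step_exists _ f l Z D e0 f1 Z1'.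
  by exists (exist _ Z' (asboolT Z'1), L).
have W0 : `[< forall z, z \in ([::] : seq V) -> N z <= 1 >] by apply/asboolP.
pose st := fix st l : W * seq (dual V) := if l is l'.+1 then
  ((F (l', st l')).1, (st l').2 ++ (F (l', st l')).2) else (exist _ [::] W0, [:: 0]).
exists (fun l => val (st l).1), (fun l => (F (l, st l)).2), (fun l => (st l).2).
split.
- by split=> // l z zl; have /asboolP := valP (st l).1; exact.
- by move=> l; have [] := FP (l, st l).
- by [].
- by move=> l; have [] := FP (l, st l).
- split=> l; have [_ _ H1 [H2 H3]] := FP (l, st l).
  + exact: H1.
  + exact: H2.
  + exact: H3.
Qed.

End blocks.

(** * Lower estimates along chains of blocks *)

Section chains.
Context {R : realType} {V : normedModType R}.
Variable N : V -> R.
Hypothesis eqN : equivalent_norm N.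
Variable r : nat.
Hypothesis r2 : (2 <= r)%N.
Variables (Zs : nat -> seq V) (Sig Ds : nat -> seq (dual V)).
Hypothesis Zs_sub : forall l, {subset Zs l <= Zs l.+1}.
Hypothesis DsS : forall l, Ds l.+1 = Ds l ++ Sig l.
Hypothesis Zs_good : forall l, good N r (Zs l.+1) (Ds l) l.+1.

Lemma Zs_mono l l' : (l <= l')%N -> {subset Zs l <= Zs l'}.
Proof.
move=> /subnKC <-; elim: (l' - l)%N => [|k IH] z; first by rewrite addn0.
by move=> /IH; rewrite addnS; exact: Zs_sub.
Qed.

Lemma Ds_mono l l' : (l <= l')%N -> {subset Ds l <= Ds l'}.
Proof.
move=> /subnKC <-; elim: (l' - l)%N => [|k IH] u; first by rewrite addn0.
by move=> /IH; rewrite addnS DsS mem_cat => ->.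
Qed.

(** A block [h] between steps [a] and [b], stored as [((a, b), h)]. In [is_link] the bound by
    [tol a - tol b] is made to telescope. *)
Definition link := (nat * nat * dual V)%type.

Definition is_link (x : link) := [/\ (x.1.1 < x.1.2)%N, dual_le N x.2 2,
  (exists u w, [/\ x.2 = u - w, u \in Ds x.1.2 & w \in Ds x.1.2]) &
  forall z, z \in Zs x.1.1 -> `|x.2 z| <= tol x.1.1 - tol x.1.2].

(** Links over successive intervals inside [[lo, hi]], each followed by a gap of at least [k].
    Adjacent links are allowed for [k = 0]; the estimates below need [k = 1]. *)
Fixpoint chain (k lo : nat) (l : seq link) (hi : nat) : Prop :=
  if l is x :: l' then [/\ (lo <= x.1.1)%N, is_link x & chain k (x.1.2 + k) l' hi]
  else (lo <= hi)%N.

Lemma chain_leq k lo l hi : chain k lo l hi -> (lo + size l <= hi)%N.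
Proof.
elim: l lo => [|x l IH] lo /=; first by rewrite addn0.
by move=> [lox [ab _ _ _] /IH]; lia.
Qed.

Lemma chain_widen k lo lo' l hi hi' : (lo' <= lo)%N -> (hi <= hi')%N ->
  chain k lo l hi -> chain k lo' l hi'.
Proof.
move=> lolo' hihi'; elim: l lo lo' lolo' => [|x l IH] lo lo' lolo' /=; first by lia.
by move=> [lox xL xl]; split=> //; [lia|exact: IH xl].
Qed.

Lemma chain_cat k lo l mid l' hi : chain k lo l mid -> chain k mid l' hi ->
  chain k lo (l ++ l') hi.
Proof.
elim: l lo => [|x l IH] lo /=; first by move=> lm; exact: chain_widen.
by move=> [lox xL xl] ml'; split=> //; exact: IH.
Qed.

Lemma chain_catI k lo l l' hi : chain k lo (l ++ l') hi ->
  exists2 mid, chain k lo l mid & chain k mid l' hi.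
Proof.
elim: l lo => [|x l IH] lo /=; first by exists lo.
by move=> [lox xL /IH[mid xl ml']]; exists mid.
Qed.

Lemma chain_filter k lo l hi (P : pred link) : chain k lo l hi -> chain k lo (seq.filter P l) hi.
Proof.
elim: l lo => [//|x l IH] lo /= [lox xL xl]; case: ifP => _; first by split=> //; exact: IH.
apply: (@chain_widen _ (x.1.2 + k) lo); [|exact: leqnn|exact: IH].
by case: xL; lia.
Qed.

Lemma chain_map k lo l hi (F : link -> link) : (forall x, (F x).1 = x.1) ->
  (forall x, is_link x -> is_link (F x)) -> chain k lo l hi -> chain k lo (map F l) hi.
Proof.
move=> F1 FL; elim: l lo => [//|x l IH] lo /= [lox xL xl].
by rewrite F1; split=> //; [exact: FL|exact: IH].
Qed.

Definition hsum (l : seq link) : dual V := \sum_(x <- l) x.2.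

Lemma hsum_cat l l' : hsum (l ++ l') = hsum l + hsum l'.
Proof. by rewrite /hsum big_cat. Qed.

Lemma chain_tol lo l hi : chain 1 lo l hi ->
  forall z, z \in Zs lo -> `|hsum l z| <= tol lo.
Proof.
elim: l lo => [|x l IH] lo /=.
  by move=> _ z _; rewrite /hsum big_nil normr0 ltW// tol_gt0.
move=> [lox [ab _ _ xz] xl] z zlo; rewrite /hsum big_cons dual_addE -/(hsum l).
have zx : z \in Zs x.1.1 by exact: Zs_mono zlo.
have zl : z \in Zs (x.1.2 + 1) by apply: Zs_mono zx; lia.
rewrite (le_trans (ler_normD _ _))//.
have := IH _ xl z zl; have := xz z zx.
have := @tol_le R x.1.2 (x.1.2 + 1) (leq_addr _ _); have := @tol_le R _ _ lox; lra.
Qed.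

(** The gap after the last link keeps all links in [Ds hi.-1], the set for which the tests [Zs hi]
    were chosen good. *)
Lemma chain_diff_sums lo l hi : chain 1 lo l hi -> (0 < hi)%N ->
  hsum l \in diff_sums (Ds hi.-1) (size l).
Proof.
elim: l lo => [|x l IH] lo /=; first by rewrite /hsum big_nil inE.
move=> [lox [ab _ [u [w [xE uD wD]]] _] xl] hi0.
have xhi := chain_leq xl.
rewrite /hsum big_cons -/(hsum l) addrC xE; apply: diff_sumsS; first exact: IH xl hi0.
  by apply: Ds_mono uD; lia.
by apply: Ds_mono wD; lia.
Qed.

Lemma ltn_exp_double i : (i < r.*2 ^ i)%N.
Proof. by apply: ltn_expl; lia. Qed.

(** Cut a chain of at most [(2r)^(i+1)] links into at most [2r] groups of at most [(2r)^i]. Each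
    group is bounded by [2 r^i], and adding one to the previous groups raises the bound by [r^i / 2]
    only, since the test set between them is good. From [r^i r] this leads to [2 r^(i+1)]. *)
Lemma chain_generation i lo l hi : (size l <= r.*2 ^ i)%N -> chain 1 lo l hi ->
  dual_le N (hsum l) (2 * r%:R ^+ i).
Proof.
elim: i lo l hi => [|i IH] lo l hi.
  rewrite expn0 expr0 mulr1; case: l => [|x [|//]] /=.
    by move=> _ _; rewrite /hsum big_nil; exact: dual_le0.
  by move=> _ [_ [_ x2 _ _] _]; rewrite /hsum big_seq1.
have k1 : 1 <= r%:R ^+ i :> R by rewrite exprn_ege1// ler1n; lia.
suff H c : (c <= r.*2)%N -> (size l <= c * r.*2 ^ i)%N -> chain 1 lo l hi ->
    dual_le N (hsum l) (r%:R ^+ i * (r%:R + c%:R / 2)).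
  move=> sl cl; rewrite expnS in sl; have := H r.*2 (leqnn _) sl cl.
  by congr (dual_le N _ _); rewrite -muln2 natrM mulfK// exprSr; ring.
elim: c l hi => [|c IHc] l hi cr sl cl.
  rewrite mul0n leqn0 size_eq0 in sl; rewrite (eqP sl) /hsum big_nil.
  by apply: dual_le0 => //; rewrite mulr_ge0// ?(le_trans _ k1)// addr_ge0.
set n := (r.*2 ^ i)%N in sl *.
have [mid cl1 cl2] : exists2 mid, chain 1 lo (take (c * n) l) mid & chain 1 mid (drop (c * n) l) hi.
  by apply: chain_catI; rewrite cat_take_drop.
have s1 : (size (take (c * n) l) <= c * n)%N by rewrite size_take; case: ltnP.
have s2 : (size (drop (c * n) l) <= n)%N by rewrite size_drop; move: sl; rewrite mulSn; lia.
have g2 := IH _ _ _ s2 cl2.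
rewrite -(cat_take_drop (c * n) l) hsum_cat.
have g1 := IHc _ _ (ltnW cr) s1 cl1.
have [sl1|sl1] := leqP (size l) (c * n).
  rewrite drop_oversize// /hsum big_nil addr0 -/(hsum _).
  apply: dual_le_widen g1 => //; rewrite ler_pM2l ?(lt_le_trans _ k1)//.
  by rewrite lerD2l ler_pM2r ?invr_gt0// ler_nat.
have {s1} s1 : size (take (c * n) l) = (c * n)%N by rewrite size_take sl1.
(* The first group has no test set before it; it is covered by [2 r^i], which is at most [r^i r]. *)
case: c => [|c] in IHc cr sl cl cl1 cl2 s1 s2 g2 g1 sl1 *.
  rewrite mul0n take0 /hsum big_nil add0r -/(hsum _).
  apply: dual_le_widen g2 => //; rewrite mulrC ler_pM2l ?(lt_le_trans _ k1)//.
  have : 2 <= r%:R :> R by rewrite ler_nat.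
  by lra.
(* Each link takes at least one step, so [mid] exceeds the number of links and [i], as [good]
   requires. *)
have mid_gt := chain_leq cl1; rewrite s1 in mid_gt.
have n_i : (i < n)%N by exact: ltn_exp_double.
have mid0 : (0 < mid)%N by move: mid_gt; rewrite mulSn; lia.
have := @Zs_good mid.-1; rewrite prednK// => good_mid.
apply: (good_mid (size (take (c.+1 * n) l)) _ i c.+1) => //.
- by rewrite s1; lia.
- exact: chain_diff_sums cl1 mid0.
- by move: mid_gt; rewrite mulSn; lia.
- exact: ltnW.
move=> z /(chain_tol cl2)/le_trans; apply.
rewrite (le_trans (@tol_le R 0 mid _))// /tol expr0 mul1r//.
Qed.

Definition neg_link (x : link) : link := (x.1, - x.2).

Lemma neg_linkP x : is_link x -> is_link (neg_link x).
Proof.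
move=> [ab x2 [u [w [xE uD wD]]] xz]; split=> //=.
- exact: dual_leN.
- by exists w, u; rewrite xE opprB.
- by move=> z /xz; rewrite -(normrN (x.2 z)).
Qed.

(** Changing signs of links keeps a chain, so all values at [b] may be taken nonnegative. *)
Lemma chain_abs_sum i lo l hi b : (size l <= r.*2 ^ i)%N -> chain 1 lo l hi -> N b <= 1 ->
  \sum_(x <- l) `|x.2 b| <= 2 * r%:R ^+ i.
Proof.
move=> sl cl b1; pose F (x : link) := if 0 <= x.2 b then x else neg_link x.
have cF : chain 1 lo (map F l) hi.
  apply: chain_map cl => x; rewrite /F; case: ifP => // _.
  exact: neg_linkP.
have := @chain_generation i lo (map F l) hi; rewrite size_map => /(_ sl cF b).
rewrite (_ : hsum (map F l) b = \sum_(x <- l) `|x.2 b|).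
  move=> /(le_trans (ler_norm _))/le_trans; apply.
  by rewrite ler_piMr// mulr_ge0.
rewrite /hsum big_map; elim: l {sl cl cF} => [|x l IH]; first by rewrite !big_nil.
rewrite !big_cons dual_addE IH; congr (_ + _); rewrite /F; case: ifP => [x0|/negbT].
  by rewrite ger0_norm.
by rewrite -ltNge => x0; rewrite ltr0_norm.
Qed.

(** Otherwise [(2r)^i] of the large links would form a chain with sum of absolute values above
    [2 r^i]. *)
Lemma chain_count i lo l hi b : chain 1 lo l hi -> N b <= 1 ->
  (count (fun x : link => (2 * 2^-1 ^+ i < `|x.2 b|)%R) l <= r.*2 ^ i)%N.
Proof.
move=> cl b1; rewrite leqNgt; apply/negP; set P := fun x : link => _ => nl.
pose l' := take (r.*2 ^ i) (seq.filter P l).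
have [mid cl' _] : exists2 mid, chain 1 lo l' mid & chain 1 mid (drop (r.*2 ^ i) (seq.filter P l)) hi.
  by apply: chain_catI; rewrite cat_take_drop; exact: chain_filter.
have sl' : size l' = (r.*2 ^ i)%N by rewrite size_take size_filter nl.
have := chain_abs_sum (eq_leq sl') cl' b1; apply/negP; rewrite -ltNge.
have l'P : all P l' by apply/allP => x /mem_take; rewrite mem_filter => /andP[].
have rE : 2 * r%:R ^+ i = \sum_(x <- l') 2 * 2^-1 ^+ i :> R.
  rewrite big_const_seq count_predT sl' iter_addr_0 -[RHS]mulr_natr natrX -muln2 natrM.
  by rewrite -mulrA -exprMn mulrCA mulVf// mulr1.
case: l' l'P sl' rE {cl'} => [|x l'] /=; first by move=> _ /eqP; rewrite eq_sym expn_eq0; lia.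
move=> /andP[Px /allP l'P] _ ->; rewrite !big_cons; apply: ltr_leD => //.
by rewrite big_seq [leRHS]big_seq; apply: ler_sum => y /l'P/ltW.
Qed.

End chains.

(** * From counting large terms to summing powers *)

Section threshold_sums.
Context {R : realType}.
Implicit Types (x : R) (c : seq R).

Lemma sum_indicator c (P : pred R) : \sum_(x <- c) (P x)%:R = (count P c)%:R :> R.
Proof.
by elim: c => [|x c IH] /=; rewrite ?big_nil// big_cons IH natrD.
Qed.

Lemma dyadic_layers q K x : 0 <= x <= 2 ->
  x ^+ q <= \sum_(k < K) (2 * 2^-1 ^+ k) ^+ q * (2 * 2^-1 ^+ k.+1 < x)%R%:R +
            (2 * 2^-1 ^+ K) ^+ q.
Proof.
move=> /andP[x0 x2]; elim: K => [|K IH].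
  by rewrite big_ord0 add0r expr0 mulr1 lerXn2r// nnegrE.
have t0 k : 0 <= 2 * 2^-1 ^+ k :> R by rewrite mulr_ge0// exprn_ge0.
rewrite big_ord_recr /=; case: ltrP => xK.
  by rewrite mulr1 (le_trans IH)// lerDl exprn_ge0.
rewrite mulr0 addr0 (le_trans (_ : _ <= (2 * 2^-1 ^+ K.+1) ^+ q))//.
  by rewrite lerXn2r// nnegrE.
by rewrite lerDr sumr_ge0// => k _; rewrite mulr_ge0// exprn_ge0.
Qed.

Lemma geometric_half_le2 K : \sum_(k < K) 2^-1 ^+ k <= 2 :> R.
Proof.
suff -> : \sum_(k < K) 2^-1 ^+ k = 2 - 2 * 2^-1 ^+ K :> R.
  by rewrite gerBl mulr_ge0// exprn_ge0.
elim: K => [|K IH]; first by rewrite big_ord0 expr0; lra.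
by rewrite big_ord_recr /= IH exprS; lra.
Qed.

(** The dyadic layer [k] contributes at most [(2 / 2^k)^q n^(k+1)], a geometric sequence of ratio at
    most 1/2. Stopping at the number [K] of terms leaves a remainder of at most [2^q], since
    [K <= 2^K]. *)
Lemma threshold_sum c (n q : nat) : (0 < q)%N -> (2 * n <= 2 ^ q)%N ->
  (forall x, x \in c -> 0 <= x <= 2) ->
  (forall k, (count (fun x => (2 * 2^-1 ^+ k < x)%R) c <= n ^ k)%N) ->
  \sum_(x <- c) x ^+ q <= 2 ^+ q * (2 * n%:R + 1).
Proof.
move=> q0 nq c2 cn; pose K := size c.
apply: (@le_trans _ _ (\sum_(x <- c) (\sum_(k < K) (2 * 2^-1 ^+ k) ^+ q *
    (2 * 2^-1 ^+ k.+1 < x)%R%:R + (2 * 2^-1 ^+ K) ^+ q))).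
  by rewrite big_seq [leRHS]big_seq; apply: ler_sum => x /c2; exact: dyadic_layers.
rewrite big_split /= exchange_big /= mulrDr mulr1 lerD//.
  apply: (@le_trans _ _ (\sum_(k < K) 2 ^+ q * n%:R * 2^-1 ^+ k)).
    apply: ler_sum => k _; rewrite -mulr_sumr sum_indicator.
    have nq' : 2^-1 ^+ q * n%:R <= 2^-1 :> R.
      rewrite exprVn mulrC ler_pdivrMr ?exprn_gt0// -ler_pdivrMl ?invr_gt0// invrK.
      by rewrite -natrM -natrX ler_nat.
    apply: (@le_trans _ _ ((2 * 2^-1 ^+ k) ^+ q * (n ^ k.+1)%:R)).
      by rewrite ler_wpM2l ?ler_nat// exprn_ge0// mulr_ge0// exprn_ge0.
    rewrite exprMn -exprM mulnC exprM natrX exprS.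
    rewrite [leLHS](_ : _ = 2 ^+ q * n%:R * (2^-1 ^+ q * n%:R) ^+ k); last first.
      by rewrite exprMn; ring.
    have h0 : 0 <= 2^-1 :> R by rewrite invr_ge0.
    apply: ler_wpM2l; first by rewrite mulr_ge0// exprn_ge0.
    by apply: lerXn2r; rewrite ?nnegrE// mulr_ge0// exprn_ge0.
  rewrite -mulr_sumr mulrA [2 ^+ q * 2 * _](_ : _ = 2 ^+ q * n%:R * 2); last by ring.
  by rewrite ler_wpM2l ?geometric_half_le2// mulr_ge0// exprn_ge0.
rewrite big_const_seq count_predT iter_addr_0 -/K -[leLHS]mulr_natr exprMn -mulrA.
rewrite -[leRHS]mulr1 ler_wpM2l ?exprn_ge0//.
apply: (@le_trans _ _ (2^-1 ^+ K * K%:R)).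
  rewrite ler_wpM2r// -{2}[2^-1 ^+ K]expr1 ler_wiXn2l// ?exprn_ge0//.
  by rewrite exprn_ile1// invf_le1// ler1n.
rewrite exprVn mulrC ler_pdivrMr ?exprn_gt0// mul1r -natrX ler_nat.
by rewrite ltnW// ltn_expl.
Qed.

End threshold_sums.

(** * The lower q-estimate for chains without gaps *)

Section chain_lower_estimate.
Context {R : realType} {V : normedModType R}.
Variable N : V -> R.
Hypothesis eqN : equivalent_norm N.
Variable r : nat.
Hypothesis r2 : (2 <= r)%N.
Variables (Zs : nat -> seq V) (Sig Ds : nat -> seq (dual V)).
Hypothesis Zs_sub : forall l, {subset Zs l <= Zs l.+1}.
Hypothesis DsS : forall l, Ds l.+1 = Ds l ++ Sig l.
Hypothesis Zs_good : forall l, good N r (Zs l.+1) (Ds l) l.+1.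

Let chain := chain N Zs Ds.

Lemma chain_links k lo (l : seq (link (V := V))) hi x : chain k lo l hi -> x \in l -> is_link N Zs Ds x.
Proof.
elim: l lo => [//|y l IH] lo /= [_ yL yl]; rewrite inE => /orP[/eqP ->//|].
exact: IH yl.
Qed.

(* Two links of a chain are separated as soon as they are not neighbours. *)
Lemma chain_split (l : seq (link (V := V))) lo hi (F : link -> R) : chain 0 lo l hi ->
  exists l1 l2, [/\ chain 1 lo l1 hi.+1, chain 1 lo.+1 l2 hi.+1 &
    \sum_(x <- l) F x = \sum_(x <- l1) F x + \sum_(x <- l2) F x].
Proof.
have [n] := ubnP (size l); elim: n l lo => // n IH [|x [|y l]] lo /= sl.
- move=> lohi; exists [::], [::]; split=> /=; [exact: leqW|by rewrite ltnS|].
  by rewrite !big_nil addr0.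
- move=> [lox xL]; rewrite addn0 => xhi; exists [:: x], [::]; split=> /=.
  + by split=> //; rewrite addn1 ltnS.
  + by rewrite ltnS (leq_trans lox)// (leq_trans _ xhi)//; case: xL => /ltnW.
  + by rewrite big_nil addr0.
move=> [lox xL [xy yL yl]]; rewrite addn0 in yl.
have sl' : (size l < n)%N by lia.
have [l1 [l2 [c1 c2 e]]] := IH l _ sl' yl.
rewrite addn0 in xy.
have xab : (x.1.1 < x.1.2)%N by case: xL.
have yab : (y.1.1 < y.1.2)%N by case: yL.
exists (x :: l1), (y :: l2); split.
- by split=> //; apply: chain_widen c1 => //; lia.
- by split=> //; [lia|rewrite addn1].
- by rewrite !big_cons e; ring.
Qed.

Lemma chain1_lower q (l : seq (link (V := V))) lo hi b : (0 < q)%N -> (4 * r <= 2 ^ q)%N ->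
  chain 1 lo l hi -> N b <= 1 ->
  \sum_(x <- l) `|x.2 b| ^+ q <= 2 ^+ q * (4 * r%:R + 1).
Proof.
move=> q0 rq cl b1.
have := @threshold_sum R [seq `|(x.2 : dual V) b| | x : link <- l] r.*2 q q0.
rewrite big_map (_ : 2 * r.*2%:R = 4 * r%:R :> R); last first.
  by rewrite -muln2 natrM; ring.
apply; first by rewrite -muln2; lia.
- move=> _ /mapP[x xl ->]; rewrite normr_ge0 /=.
  have [_ x2 _ _] := chain_links cl xl.
  by rewrite (le_trans (x2 b))// ler_piMr.
- move=> k; rewrite count_map.
  exact: chain_count cl b1.
Qed.

Definition lower_constant (q : nat) : R := 2 * (2 ^+ q * (4 * r%:R + 1)).

Lemma chain_lower q (l : seq (link (V := V))) lo hi b : (0 < q)%N -> (4 * r <= 2 ^ q)%N ->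
  chain 0 lo l hi ->
  \sum_(x <- l) `|x.2 b| ^+ q <= lower_constant q * N b ^+ q.
Proof.
move=> q0 rq cl.
have [Nb|Nb] := eqVneq (N b) 0.
  rewrite Nb expr0n eqn0Ngt q0 mulr0 big_seq big1// => x xl.
  have [_ /(_ b)] := chain_links cl xl.
  by rewrite Nb mulr0 normr_le0 => /eqP ->; rewrite normr0 expr0n eqn0Ngt q0.
have {}Nb : 0 < N b by rewrite lt_def Nb equiv_ge0.
rewrite -ler_pdivrMr ?exprn_gt0// mulr_suml.
pose b' := (N b)^-1 *: b.
have b'1 : N b' <= 1.
  by rewrite (equivZ eqN) gtr0_norm ?invr_gt0// mulVf// gt_eqF.
rewrite (eq_bigr (fun x : link => `|x.2 b'| ^+ q)); last first.
  move=> x _; rewrite /b' linearZ normrM gtr0_norm ?invr_gt0// exprMn exprVn.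
  by rewrite mulrC.
have [l1 [l2 [c1 c2 ->]]] := chain_split (fun x : link => `|x.2 b'| ^+ q) cl.
rewrite /lower_constant mulr_natl mulr2n lerD//.
  exact: chain1_lower c1 b'1.
exact: chain1_lower c2 b'1.
Qed.

End chain_lower_estimate.

(** * Embedding into a tree space *)

Section closed_range.
Context {R : realType} {V : completeNormedModType R} {W : normedModType R}.

(** The approximate preimages of a point of the closure form a Cauchy filter, because [T] is bounded
    below; its limit is a preimage. *)
Lemma closed_range_bounded_below (T : {linear V -> W}) (c : R) : continuous T -> 0 < c ->
  (forall x, c * `|x| <= `|T x|) -> closed (range T).
Proof.
move=> Tc c0 cT y cy.
pose F := filter_from [set e : R | 0 < e] (fun e => [set x | `|T x - y| < e]).
have FF : ProperFilter F.
  apply: filter_from_proper.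
    apply: filter_from_filter; first by exists 1 => /=.
    move=> e e' /= e0 e'0; exists (Num.min e e'); first by rewrite /= lt_min e0.
    by move=> x /=; rewrite lt_min => /andP[].
  move=> e /= e0.
  have [_ [[x _ <-] xy]] := cy _ (nbhsx_ballx y e e0).
  by exists x; move: xy; rewrite -ball_normE /= distrC.
have Fc : cauchy F.
  apply: cauchy_exP => e e0; have e2 : 0 < c * e / 2 by rewrite !(divr_gt0, mulr_gt0).
  have [x0 x0y] : exists x0, `|T x0 - y| < c * e / 2.
    have [_ [[x _ <-] xy]] := cy _ (nbhsx_ballx y _ e2).
    by exists x; move: xy; rewrite -ball_normE /= distrC.
  exists x0; exists (c * e / 2) => // x /= xy; rewrite -ball_normE /=.
  rewrite -(ltr_pM2l c0) (le_lt_trans (cT _))// linearB /=.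
  rewrite -(subrKA y) (le_lt_trans (ler_normD _ _))// [X in _ + X]distrC.
  by rewrite (splitr (c * e)) ltrD.
have /cvg_ex[x0 Fx0] : cvg F by exact: cauchy_cvg.
exists x0 => //; apply/eqP; rewrite -subr_eq0 -normr_le0; apply/ler_addgt0Pl => e e0.
rewrite addr0; have e2 : 0 < e / 2 by rewrite divr_gt0.
have Tx0 : \forall x \near x0, `|T x0 - T x| < e / 2.
  by have /cvgrPdist_lt/(_ _ e2) := Tc x0.
have FTx0 : F [set x | `|T x0 - T x| < e / 2] := Fx0 _ Tx0.
have Fy : F [set x | `|T x - y| < e / 2] by exists (e / 2).
have [x [x1 x2]] := filter_ex (filterI FTx0 Fy).
rewrite -(subrKA (T x)) (splitr e) (le_trans (ler_normD _ _))//.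
by rewrite lerD// ltW.
Qed.

End closed_range.

(** * Walks through the scheme and the resulting embedding *)

Section embedding.
Context {R : realType} {V : completeNormedModType R}.
Variable N : V -> R.
Hypothesis eqN : equivalent_norm N.
Variable r : nat.
Hypothesis r2 : (2 <= r)%N.
Variables (f : nat -> dual V).
Variables (Zs : nat -> seq V) (Sig Ds : nat -> seq (dual V)).
Hypothesis f_norming : forall x, exists n, N x / 2 <= `|f n x|.
Hypothesis f1 : forall n, unit_ball N (f n).
Hypothesis Zs0 : Zs 0 = [::].
Hypothesis Zs_sub : forall l, {subset Zs l <= Zs l.+1}.
Hypothesis Ds0 : Ds 0 = [:: 0].
Hypothesis DsS : forall l, Ds l.+1 = Ds l ++ Sig l.
Hypothesis Zs_good : forall l, good N r (Zs l.+1) (Ds l) l.+1.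
Hypothesis Sig1 : forall l u, u \in Sig l -> unit_ball N u.
Hypothesis Sigf : forall l, f l \in Sig l.
Hypothesis Sig_net : forall l u, unit_ball N u -> exists2 v, v \in Sig l &
  forall z, z \in Zs l.+1 -> `|u z - v z| <= tol l.+1 / 4.

(** The number of steps made, whether all letters so far were meaningful, and the current
    functional. *)
Definition walk_state := (nat * bool * dual V)%type.

(** The bound [tol l / 2] equals [tol l - tol l.+1], so that moves add up to the bound for links. *)
Definition admissible (l : nat) (v u : dual V) : bool :=
  `[< forall z, z \in Zs l -> `|u z - v z| <= tol l / 2 >].

(* A letter [(i, e)] at step [l] is meaningful when [i + e + 1] is the size of
   [Sig l]; it then moves to the [i]-th element of [Sig l]. This makes the rank
   of a meaningful word depend on its length only. *)
Definition walk_step (st : walk_state) (c : nat * nat) : walk_state :=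
  let l := st.1.1 in
  let alive := st.1.2 && ((c.1 + c.2).+1 == size (Sig l)) in
  let u := nth 0 (Sig l) c.1 in
  (l.+1, alive, if alive && admissible l st.2 u then u else st.2).

Definition walk (s : word) : walk_state := foldl walk_step (0, true, 0) s.

Definition alive s := (walk s).1.2.
Definition position s := (walk s).2.

Lemma walk_rcons s c : walk (rcons s c) = walk_step (walk s) c.
Proof. by rewrite /walk foldl_rcons. Qed.

Lemma walk_length s : (walk s).1.1 = size s.
Proof.
by elim/last_ind: s => [//|s c IH]; rewrite walk_rcons size_rcons /= IH.
Qed.

Lemma alive_rcons s c : alive (rcons s c) = alive s && ((c.1 + c.2).+1 == size (Sig (size s))).
Proof. by rewrite /alive walk_rcons /= walk_length. Qed.

Lemma position_rcons s c : position (rcons s c) =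
  if alive (rcons s c) && admissible (size s) (position s) (nth 0 (Sig (size s)) c.1)
  then nth 0 (Sig (size s)) c.1 else position s.
Proof. by rewrite alive_rcons /position walk_rcons /= walk_length. Qed.

(** The common rank of all alive words of length [l]. *)
Definition level (l : nat) : nat := \sum_(i < l) size (Sig i).

Lemma levelS l : level l.+1 = (level l + size (Sig l))%N.
Proof. by rewrite /level big_ord_recr. Qed.

Lemma level_ltS l : (level l < level l.+1)%N.
Proof.
rewrite levelS -[X in (X < _)%N]addn0 ltn_add2l.
by have := Sigf l; case: (Sig l).
Qed.

Lemma level_mono l l' : (l <= l')%N -> (level l <= level l')%N.
Proof.
move=> /subnKC <-; elim: (l' - l)%N => [|k IH]; first by rewrite addn0.
by rewrite addnS (leq_trans IH)// ltnW// level_ltS.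
Qed.

Lemma leq_level l : (l <= level l)%N.
Proof. by elim: l => // l IH; rewrite (leq_ltn_trans IH)// level_ltS. Qed.

Lemma rank_alive s : alive s -> rank s = level (size s).
Proof.
elim/last_ind: s => [_|s c IH].
  by rewrite /rank /level big_nil big_ord0.
by rewrite alive_rcons size_rcons levelS rank_rcons => /andP[/IH -> /eqP ->].
Qed.

Lemma take_rcons s l : (l < size s)%N -> take l.+1 s = rcons (take l s) (nth (0, 0)%N s l).
Proof. exact: take_nth. Qed.

Lemma alive_take s a b : (a <= b)%N -> alive (take b s) -> alive (take a s).
Proof.
move=> /subnKC <-; elim: (b - a)%N => [|k IH]; first by rewrite addn0.
rewrite addnS; have [ks|ks] := ltnP (a + k) (size s).
  by rewrite take_rcons// alive_rcons => /andP[/IH].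
by rewrite take_oversize ?(leq_trans ks)// => al; apply: IH; rewrite take_oversize.
Qed.

Lemma position_Ds s : position s \in Ds (size s).
Proof.
elim/last_ind: s => [|s c IH]; first by rewrite Ds0 inE.
rewrite size_rcons DsS mem_cat position_rcons; case: ifP => [|_]; last by rewrite IH.
rewrite alive_rcons => /andP[/andP[_ /eqP cs] _].
by rewrite mem_nth ?orbT// -cs ltnS leq_addr.
Qed.

Lemma Ds_unit l u : u \in Ds l -> unit_ball N u.
Proof.
elim: l => [|l IH]; first by rewrite Ds0 inE => /eqP ->; exact: dual_le0.
by rewrite DsS mem_cat => /orP[/IH|/Sig1].
Qed.

Lemma position_tol s a b z : (a <= b <= size s)%N -> z \in Zs a ->
  `|position (take b s) z - position (take a s) z| <= tol a - tol b.
Proof.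
move=> /andP[/subnKC <-]; elim: (b - a)%N => [|k IH].
  by rewrite addn0 !subrr normr0.
rewrite addnS => ks za; have {}IH := IH (ltnW ks) za.
rewrite take_rcons// position_rcons size_take ks; case: ifP => [/andP[_ /asboolP adm]|_].
  rewrite -(subrKA (position (take (a + k) s) z)) (le_trans (ler_normD _ _))//.
  have := adm z (Zs_mono Zs_sub (leq_addr k a) za); rewrite tolS.
  by move: IH; lra.
by rewrite (le_trans IH)// lerD2l lerN2 tol_le.
Qed.

(** The position is frozen once the walk is no longer alive, so a segment may be ended at an alive
    prefix, whose rank is known. *)
Lemma position_link s a b : (a <= b <= size s)%N ->
  position (take b s) = position (take a s) \/
  exists b', [/\ (a < b' <= b)%N, alive (take b' s) & position (take b s) = position (take b' s)].
Proof.
move=> /andP[/subnKC <-]; elim: (b - a)%N => [|k IH]; first by rewrite addn0; left.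
rewrite addnS => ks; have [al|al] := boolP (alive (take (a + k).+1 s)).
  by right; exists (a + k).+1; rewrite al ltnS leq_addr leqnn.
have -> : position (take (a + k).+1 s) = position (take (a + k) s).
  by move: al; rewrite take_rcons// position_rcons => /negPf ->.
have [->|[b' [/andP[ab' b'k] alb' e]]] := IH (ltnW ks); first by left.
by right; exists b'; rewrite ab' (leq_trans b'k).
Qed.

Definition increment (p : node) : dual V := position (rcons p.1 p.2) - position p.1.

Lemma pairing_segment s a b (x : V) : (a <= b <= size s)%N ->
  pairing (segment s a b) (fun p => increment p x) =
  (position (take b s) x : R) - position (take a s) x.
Proof.
move=> /andP[ab bs]; have [k kE] : exists k, (b - a)%N = k by exists (b - a)%N.
elim: k a kE ab => [|k IH] a kE ab.
  have -> : a = b by lia.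
  by rewrite segment_nil// pairing_nil subrr.
have ab' : (a < b)%N by lia.
rewrite segment_cons// pairing_cons IH ?mul1r//; last by lia.
rewrite /increment /= -take_rcons ?(leq_trans ab')//.
rewrite -[(_ - _) x]/((position (take a.+1 s) x : R) - position (take a s) x).
by rewrite addrC subrKA.
Qed.

(** Translates ranks into steps: an alive node at depth [j] has rank [level j.+1], and by
    [index_belowP] this is below [m] exactly for [j < index_below m]. *)
Definition index_below (m : nat) : nat :=
  ex_minn (ex_intro (fun j => m <= level j.+1)%N m (ltnW (leq_level m.+1))).

Lemma index_belowP m j : (level j.+1 < m)%N = (j < index_below m)%N.
Proof.
rewrite /index_below; case: ex_minnP => i mi min_i.
apply/idP/idP => [jm|ji].
  rewrite ltnNge; apply/negP => ij; move: jm; rewrite ltnNge (leq_trans mi)//.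
  by rewrite level_mono.
by rewrite ltnNge; apply/negP => /min_i; rewrite leqNgt ji.
Qed.

Lemma index_below_leq m n : (m <= n)%N -> (index_below m <= index_below n)%N.
Proof.
move=> mn; rewrite leqNgt; apply/negP; rewrite -index_belowP => nm.
have := leq_trans nm mn; rewrite index_belowP ltnn.
by [].
Qed.

(** This explains the coefficients of a join. With [t = v^(q+2)] the left side is a power of the
    convex combination of [X] and [Y / v] with weights [1 - t] and [t], and [t (Y / v)^(q+2)] is
    [Y^(q+2)]. *)
Lemma jensen_join q (v X Y : R) : 0 <= v <= 1 -> 0 <= X -> 0 <= Y ->
  ((1 - v ^+ q.+2) * X + v ^+ q.+1 * Y) ^+ q.+2 <= X ^+ q.+2 + Y ^+ q.+2.
Proof.
move=> /andP[v0 v1] X0 Y0; have [->|v_neq0] := eqVneq v 0.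
  by rewrite !exprS !mul0r subr0 mul1r addr0 -!exprS lerDl exprn_ge0.
have {v_neq0}v0 : 0 < v by rewrite lt_def v_neq0.
pose t := v ^+ q.+2; have t0 : 0 <= t by rewrite exprn_ge0// ltW.
have t1 : t <= 1 by rewrite exprn_ile1// ltW.
have -> : v ^+ q.+1 * Y = t * (Y / v) by rewrite /t [v ^+ q.+2]exprSr -mulrA [v * _]mulrC divfK// gt_eqF.
have Yv : 0 <= Y / v by rewrite divr_ge0// ltW.
have convex k : ((1 - t) * X + t * (Y / v)) ^+ k <= (1 - t) * X ^+ k + t * (Y / v) ^+ k.
  move: (Y / v) Yv => Z Z0; elim: k => [|k IH]; first by rewrite !expr0; lra.
  have XZ : 0 <= (1 - t) * X + t * Z by rewrite addr_ge0// mulr_ge0// subr_ge0.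
  rewrite exprS (le_trans (ler_wpM2l XZ IH))// -subr_ge0.
  (* Both differences have the same sign by monotonicity of powers. *)
  rewrite [leRHS](_ : _ = t * (1 - t) * ((X - Z) * (X ^+ k - Z ^+ k))).
    apply: mulr_ge0; first by rewrite mulr_ge0// subr_ge0.
    have [XlZ|ZlX] := lerP X Z.
      by rewrite mulr_le0 ?subr_le0// lerXn2r// nnegrE.
    by rewrite mulr_ge0 ?subr_ge0 ?(ltW ZlX)// lerXn2r ?nnegrE// ltW.
  by rewrite !exprS; ring.
apply: le_trans (convex q.+2) _; rewrite expr_div_n -/t [t * _]mulrCA mulfV ?mulr1; last by rewrite gt_eqF// exprn_gt0.
by rewrite lerD2r ler_piMl ?exprn_ge0// gerBl.
Qed.

(** By induction on the functional: a segment telescopes to at most one link, and a join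
    concatenates two chains, since its parts have successive ranges of ranks; [jensen_join] adds the
    powers. *)
Lemma treeK_chain q m n z (x : V) : treeK q m n z ->
  exists2 l : seq (link (V := V)), chain N Zs Ds 0 (index_below m) l (index_below n) &
    `|pairing z (fun p => increment p x)| ^+ q.+2 <= \sum_(y <- l) `|y.2 x| ^+ q.+2.
Proof.
elim=> {m n z}.
- move=> m n mn; exists [::]; first exact: index_below_leq.
  by rewrite pairing_nil normr0 expr0n big_nil.
- move=> m n z _ [l cl zl]; exists l => //.
  by rewrite pairing_scale mulN1r normrN.
- move=> m n s a b mn ab bs ma bn; have abs : (a <= b <= size s)%N by rewrite ltnW.
  rewrite pairing_segment//.
  have [e|[b' [/andP[ab' b'b] alb' e]]] := position_link abs.
    exists [::]; first exact: index_below_leq.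
    by rewrite e subrr normr0 expr0n big_nil.
  have b's : (b' <= size s)%N by exact: leq_trans bs.
  pose y : link := ((a, b'), position (take b' s) - position (take a s)).
  exists [:: y]; last by rewrite big_seq1 e.
  have yL : is_link N Zs Ds y.
    split=> //=.
    + rewrite [2](_ : _ = 1 + 1)//; apply: dual_leD; last apply: dual_leN.
        exact: Ds_unit (position_Ds _).
      exact: Ds_unit (position_Ds _).
    + exists (position (take b' s)), (position (take a s)); split=> //.
        by have := position_Ds (take b' s); rewrite size_takel.
      have := position_Ds (take a s); rewrite size_takel; last by rewrite (leq_trans _ b's)// ltnW.
      by apply: (Ds_mono DsS); exact: ltnW.
    + by move=> z za; apply: position_tol => //; rewrite b's ltnW.
  split=> //=.
    rewrite leqNgt -index_belowP -leqNgt (leq_trans ma)//.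
    have ala := alive_take ab' alb'.
    by rewrite (rank_alive ala) size_takel// (leq_trans _ b's).
  (* The last node used has depth [b' - 1] and rank [level b'], which is below [n]. *)
  rewrite addn0 -(ltn_predK ab') -index_belowP (ltn_predK ab').
  apply: leq_ltn_trans bn; rewrite -[b' in level b'](size_takel b's) -rank_alive//.
  exact: leq_rank_take.
- move=> m n k g h v Kg [l cl gl] Kh [l' cl' hl'] v01; exists (l ++ l').
    exact: chain_cat cl cl'.
  rewrite big_cat /= (le_trans _ (lerD gl hl'))//.
  rewrite pairing_cat !pairing_scale; apply: le_trans (jensen_join q v01 (normr_ge0 _) (normr_ge0 _)).
  have /andP[v0 v1] := v01.
  rewrite lerXn2r ?nnegrE//.
    by rewrite addr_ge0// mulr_ge0// ?subr_ge0 ?exprn_ile1// exprn_ge0.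
  rewrite (le_trans (ler_normD _ _))// !normrM.
  by rewrite (ger0_norm (exprn_ge0 _ v0)) ger0_norm// subr_ge0 exprn_ile1.
Qed.

Variable q : nat.
Hypothesis rq : (4 * r <= 2 ^ q.+2)%N.

Lemma lower_constant_ge1 : 1 <= lower_constant (R := R) r q.+2.
Proof.
have h : 1 <= 2 ^+ q.+2 :> R by rewrite exprn_ege1// ler1n.
rewrite /lower_constant.
have : 1 <= 2 ^+ q.+2 * (4 * r%:R + 1) :> R.
  by rewrite -[leLHS]mul1r ler_pM// lerDr mulr_ge0.
lra.
Qed.

Lemma increment_bound x z : tree_K q z ->
  `|pairing z (fun p => increment p x)| <= lower_constant r q.+2 * N x.
Proof.
move=> [n Kz]; have [l cl zl] := treeK_chain x Kz.
have C1 := lower_constant_ge1; have C0 := le_trans ler01 C1.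
rewrite -(@ler_pXn2r _ q.+2)// ?nnegrE//; last by rewrite mulr_ge0// equiv_ge0.
rewrite (le_trans zl)// (le_trans (chain_lower eqN r2 Zs_sub DsS Zs_good x _ rq cl))//.
rewrite exprMn ler_wpM2r// ?exprn_ge0 ?equiv_ge0//.
(* The constant is at least 1, hence at most its own power, which avoids taking roots. *)
by rewrite -{1}[lower_constant _ _]expr1 ler_weXn2l.
Qed.

Lemma tree_mapP x : (fun p => increment p x : R) \in npred (@tree_norming R q).
Proof.
apply/asboolP; split=> //; exists (lower_constant r q.+2 * N x) => z Kz.
exact: increment_bound.
Qed.

Definition tree_map x : @tree_space R q := NSpace (tree_mapP x).

Lemma tree_map_linear : linear tree_map.
Proof.
by move=> a x y; apply/val_inj/funext => p; exact: (functional_linear (increment p) a x y).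
Qed.

HB.instance Definition _ := GRing.isLinear.Build R V (@tree_space R q) *:%R
  tree_map tree_map_linear.

Lemma tree_map_upper x : `|tree_map x| <= lower_constant r q.+2 * N x.
Proof. by apply: nnorm_le => z; exact: increment_bound. Qed.

(** Two successive approximations of [f n] differ on the test vectors by at most
    [tol l / 4 + tol l / 8], so the move between them is admissible. *)
Lemma follow_step s n u : alive s -> u \in Sig (size s) ->
  (forall z, z \in Zs (size s) -> `|f n z - position s z| <= tol (size s) / 4) ->
  (forall z, z \in Zs (size s).+1 -> `|f n z - u z| <= tol (size s).+1 / 4) ->
  exists s', [/\ size s' = (size s).+1, alive s' & position s' = u].
Proof.
move=> als us fs fu; pose i := index u (Sig (size s)).
have iS : (i < size (Sig (size s)))%N by rewrite index_mem.
(* The padding makes the letter meaningful. *)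
exists (rcons s (i, size (Sig (size s)) - i.+1)%N); rewrite size_rcons.
have al : alive (rcons s (i, size (Sig (size s)) - i.+1)%N).
  by rewrite alive_rcons als /=; apply/eqP; lia.
split=> //; rewrite position_rcons al /= nth_index// ifT//; apply/asboolP => z zs.
rewrite -(subrKA (f n z)) (le_trans (ler_normD _ _))// [X in X + _]distrC.
have := fs z zs; have := fu z (Zs_sub zs); rewrite tolS.
by have := @tol_gt0 R (size s); lra.
Qed.

(** For [n] steps the walk follows [f n] through net points; at step [n] it reaches [f n] itself,
    which was put into [Sig n]. *)
Lemma follow n : exists s, [/\ size s = n.+1, alive s & position s = f n].
Proof.
have [s [ss als fs]] : exists s, [/\ size s = n, alive s &
    forall z, z \in Zs n -> `|f n z - position s z| <= tol n / 4].
  suff H k : exists s, [/\ size s = k, alive s &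
    forall z, z \in Zs k -> `|f n z - position s z| <= tol k / 4] by exact: H.
  elim: k => [|k [s [ss als fs]]]; first by exists [::]; split=> // z; rewrite Zs0.
  have [u uk fu] := Sig_net k (f1 n).
  rewrite -ss in uk fs fu; have [s' [ss' als' ps']] := follow_step als uk fs fu.
  by exists s'; rewrite ss' ss ps' als' -ss.
rewrite -[in Zs _]ss -[in tol _]ss in fs.
have fn : f n \in Sig (size s) by rewrite ss.
have [|s' [ss' als' ps']] := follow_step als fn fs.
  by move=> z _; rewrite subrr normr0 divr_ge0// ltW// tol_gt0.
by exists s'; rewrite ss' ss.
Qed.

Lemma tree_map_lower x : N x / 2 <= `|tree_map x|.
Proof.
have [n fx] := f_norming x; have [s [ss als ps]] := follow n.
rewrite (le_trans fx)//.
have Ks : treeK (R := R) q 0 (rank s).+1 (segment s 0 (size s)).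
  by apply: treeK_segment => //; rewrite ?ss// take_oversize// ss.
have := le_treeK (tree_map x) Ks; rewrite pairing_segment ?leqnn//.
by rewrite take_size take0 ps /position /= subr0.
Qed.

Lemma tree_map_embedding : isomorphic_to_closed_subspace V (@tree_space R q).
Proof.
have [C C0 NC] := equiv_upper eqN; have [c c0 cN] := equiv_lower eqN.
have Tc : continuous (tree_map : {linear V -> @tree_space R q}).
  apply: (@bounded_linear_map _ _ _ _ (lower_constant r q.+2 * C)) => x.
  rewrite (le_trans (tree_map_upper x))// -mulrA ler_wpM2l//.
  exact: le_trans ler01 lower_constant_ge1.
have low x : c / 2 * `|x| <= `|tree_map x|.
  by rewrite (le_trans _ (tree_map_lower x))// mulrAC ler_pM2r ?invr_gt0.
have c2 : 0 < c / 2 by rewrite divr_gt0.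
exists (tree_map : {linear V -> @tree_space R q}); split=> //.
  exact: closed_range_bounded_below Tc c2 low.
by exists (c / 2).
Qed.

End embedding.

(** * The universal space as an l2-sum over all exponents *)

Section universal_space.
Context {R : realType}.

Definition root_node : node := ([::], (0, 0)%N).

Lemma tree_norming_full q : nP (@tree_norming R q) = setT.
Proof. by []. Qed.

Definition universal_space : completeNormedModType R := l2_space (@tree_norming R).

Lemma universal_banach : banach universal_space.
Proof.
exact: (@l2_banach R node (@tree_norming R) tree_norming_full root_node
  (@delta_bounded R) (@tree_dense R)).
Qed.

Lemma universal_dual_banach : dual_banach universal_space.
Proof. exact: (@l2_dual_banach R node (@tree_norming R) root_node (@delta_bounded R)). Qed.

Lemma C_auc_tree_space (B : completeNormedModType R) : C_auc B ->
  exists q, isomorphic_to_closed_subspace B (@tree_space R q).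
Proof.
move=> [[sB _] reflB [N [eqN aucN]]].
have [r r2 smoothN] := auc_dual_smooth eqN reflB aucN.
have [f [f1 f_norming]] := norming_sequence eqN sB.
have [Zs [Sig [Ds [[Zs0 _] Zs_sub [Ds0 DsS] Zs_good [Sig1 Sigf Sig_net]]]]] :=
  scheme_exists r2 smoothN f1.
(* Any [q] with [4 r <= 2^(q+2)] serves; only [r] depends on the space. *)
exists (4 * r)%N.
apply: (tree_map_embedding eqN r2 f_norming f1 Zs0 Zs_sub Ds0 DsS Zs_good Sig1 Sigf Sig_net).
by rewrite ltnW// (ltn_trans (ltn_expl (4 * r) (ltnSn 1)))// ltn_exp2l//; lia.
Qed.

Lemma universal_embedding : universal_for universal_space (@C_auc R).
Proof.
move=> B /C_auc_tree_space[q [T [Tc _ [c c0 cT]]]].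
have norm_embed (x : @tree_space R q) :
    `|l2_embed (D := @tree_norming R) x| = `|x|.
  exact: norm_l2_embed.
pose J : {linear @tree_space R q -> universal_space} := @l2_embed R node (@tree_norming R) q.
have Jc : continuous J.
  by apply: (@bounded_linear_map _ _ _ J 1) => x; rewrite mul1r norm_embed.
pose JT : {linear B -> universal_space} := J \o T.
have JTc : continuous JT by move=> x; apply: continuous_comp; [exact: Tc|exact: Jc].
have JT_low x : c * `|x| <= `|JT x| by rewrite /JT /= norm_embed.
exists JT; split=> //; last by exists c.
exact: closed_range_bounded_below JTc c0 JT_low.
Qed.

End universal_space.


Theorem proposition5p5 (R : realType) :
  exists X : completeNormedModType R,
    [/\ banach X,
        dual_banach X,
        universal_for X (@C_auc R) &
        exists E : nat -> completeNormedModType R,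
          (forall n, banach (E n) /\ auc (E n)) /\ is_l2_sum X E].
Proof.
exists universal_space; split.
- exact: universal_banach.
- exact: universal_dual_banach.
- exact: universal_embedding.
- exists (@tree_space R); split.
    by move=> n; split; [exact: tree_banach|exact: tree_auc].
  exact: (@l2_is_l2_sum R node (@tree_norming R) tree_norming_full).
Qed.
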